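(* Assume $\|\nabla_{\mathbf{x}} f(\mathbf{x})\|\le L$ for all $\mathbf{x}\in\mathcal{X}$, and that $\nu^2=\left\|\int\left(\nabla_{\mathbf{x}} f\,\nabla_{\mathbf{x}} f^T-C\right)^2\rho\,d\mathbf{x}\right\|>0$. Let $1\le n<m$ and let $\varepsilon>0$ be such that $$\varepsilon\;\le\;\min\left(1,\;\frac{\lambda_n-\lambda_{n+1}}{5\lambda_1}\right).$$ Let $\delta=\max\left(\frac{\nu^2}{\lambda_1\varepsilon},\,L^2\right)$ and choose the number of samples $N=\Omega\left(\frac{\delta}{\lambda_1\varepsilon}\log(2m)\right)$. Then $$\operatorname{dist}\big(\operatorname{ran}(W_1),\operatorname{ran}(\hat{W}_1)\big)\;\le\;\frac{4\lambda_1\varepsilon}{\lambda_n-\lambda_{n+1}}$$ with high probability. That is: for every $\beta>0$ there is a constant $c>0$ depending only on $\beta$ such that, whenever $N\ge c\,\frac{\delta}{\lambda_1\varepsilon}\log(2m)$, the displayed inequality holds with probability at least $1-m^{-\beta}$.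
   Context: Setting: $m>1$ is an integer and $\mathcal{X}\subseteq\mathbb{R}^m$ is centered at the origin and scaled so that all components of $\mathbf{x}\in\mathcal{X}$ have the same range. $\rho:\mathbb{R}^m\to\mathbb{R}_+$ is a bounded probability density (it integrates to 1), separable (a product of univariate functions of the coordinates), strictly positive on $\mathcal{X}$ and zero outside $\mathcal{X}$. The function $f:\mathcal{X}\to\mathbb{R}$ is differentiable and absolutely continuous, with gradient $\nabla_{\mathbf{x}} f$ written as a column vector. Define $C=\int (\nabla_{\mathbf{x}} f)(\nabla_{\mathbf{x}} f)^T\,\rho\,d\mathbf{x}=W\Lambda W^T$, a symmetric positive semidefinite $m\times m$ matrix, with $W$ orthogonal and $\Lambda=\mathrm{diag}(\lambda_1,\dots,\lambda_m)$, $\lambda_1\ge\cdots\ge\lambda_m\ge0$. Let $\mathbf{x}_1,\dots,\mathbf{x}_N$ be independent samples from $\rho$ and $\hat{C}=\frac1N\sum_{j=1}^N \nabla_{\mathbf{x}} f(\mathbf{x}_j)\nabla_{\mathbf{x}} f(\mathbf{x}_j)^T=\hat{W}\hat{\Lambda}\hat{W}^T$ its eigendecomposition, with $\hat W$ orthogonal and eigenvalues in decreasing order. $W_1$ and $\hat{W}_1$ consist of the first $n$ columns of $W$ and $\hat{W}$ respectively. Norms are Euclidean norms of vectors and spectral (operator 2-) norms of matrices. For matrices $A,B$ with $n$ orthonormal columns, $\operatorname{dist}(\operatorname{ran}(A),\operatorname{ran}(B))=\|AA^T-BB^T\|$. The notation $a=\Omega(b)$ means $a\ge cb$ for some positive constant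 $c$; ''with high probability'' means with probability at least $1-m^{-\beta}$ for a prescribed $\beta>0$, the constant $c$ depending only on $\beta$. *)

(* Defs.v *)
From HB Require Import structures.
From mathcomp Require Import all_boot all_order all_algebra.
From mathcomp Require Import all_classical all_reals all_analysis.
Set Implicit Arguments.
Unset Strict Implicit.
Unset Printing Implicit Defensive.
Import Order.TTheory GRing.Theory Num.Theory.
Import numFieldNormedType.Exports.
Local Open Scope classical_set_scope.
Local Open Scope ring_scope.

(* The sigma-algebra on column vectors is the one generated by the coordinates,
   i.e. the Borel sigma-algebra of R^m. *)
Definition colvec_display : measure_display. Proof. by constructor. Qed.

Section colvec_measurable.
Context {R : realType} {m : nat}.

Definition colvec_coord (i : 'I_m) (x : 'cV[R]_m) : measurableTypeR R := x i 0.

Let colvec0 : g_sigma_preimage colvec_coord set0.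
Proof. exact: sigma_algebra0. Qed.

Let colvecC A : g_sigma_preimage colvec_coord A ->
  g_sigma_preimage colvec_coord (~` A).
Proof. exact: sigma_algebraC. Qed.

Let colvec_bigcup (F : _^nat) : (forall i, g_sigma_preimage colvec_coord (F i)) ->
  g_sigma_preimage colvec_coord (\bigcup_i (F i)).
Proof. exact: sigma_algebra_bigcup. Qed.

HB.instance Definition _ := @isMeasurable.Build colvec_display
  'cV[R]_m (g_sigma_preimage colvec_coord) colvec0 colvecC colvec_bigcup.

Lemma measurable_colvec_coord i : measurable_fun [set: 'cV[R]_m] (colvec_coord i).
Proof.
move=> _ Y mY; rewrite setTI; apply: sub_sigma_algebra => /=.
rewrite -bigcup_seq/=; exists i => /=; first by rewrite mem_index_enum.
by exists Y => //; rewrite setTI.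
Qed.

Lemma measurable_fun_colvecP d (T : measurableType d) (f : T -> 'cV[R]_m) :
  measurable_fun [set: T] f <->
  forall i, measurable_fun [set: T] (colvec_coord i \o f).
Proof.
split=> [mf i|mf].
  exact: measurableT_comp (measurable_colvec_coord i) mf.
move=> _ A mA; rewrite setTI.
have : preimage_set_system setT f (g_sigma_preimage colvec_coord) (f @^-1` A).
  by exists A => //; rewrite setTI.
rewrite -g_sigma_preimage_comp; apply: smallest_sub.
  exact: sigma_algebra_measurable.
rewrite -bigcup_seq; apply: bigcup_sub => i _ B [C mC <-].
by apply: mf.
Qed.

End colvec_measurable.

Section lebesgue_colvec.
Context {R : realType}.

Definition colvec_cons n (p : measurableTypeR R * 'cV[R]_n) : 'cV[R]_n.+1 :=
  col_mx (const_mx p.1 : 'cV[R]_1) p.2.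

Definition colvec_uncons n (v : 'cV[R]_n.+1) : measurableTypeR R * 'cV[R]_n :=
  (v 0 0, dsubmx (v : 'cV[R]_(1 + n))).

Lemma colvec_cons0 n p : @colvec_cons n p 0 0 = p.1.
Proof.
rewrite /colvec_cons (_ : 0 = lshift n (0 : 'I_1) :> 'I_n.+1); last exact/val_inj.
by rewrite (col_mxEu (const_mx p.1 : 'cV[R]_1) p.2) mxE.
Qed.

Lemma colvec_consS n p i : @colvec_cons n p (lift ord0 i) 0 = p.2 i 0.
Proof.
rewrite /colvec_cons (_ : lift ord0 i = rshift 1 i :> 'I_n.+1); last exact/val_inj.
by rewrite (col_mxEd (const_mx p.1 : 'cV[R]_1) p.2).
Qed.

Lemma colvec_consK n : cancel (@colvec_cons n) (@colvec_uncons n).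
Proof.
move=> [x v]; rewrite /colvec_uncons colvec_cons0.
by rewrite /colvec_cons (col_mxKd (const_mx x : 'cV[R]_1) v).
Qed.

Lemma measurable_colvec_cons n : measurable_fun setT (@colvec_cons n).
Proof.
apply/measurable_fun_colvecP => i; have [j ->|->] := unliftP ord0 i.
  rewrite (_ : _ \o _ = colvec_coord j \o snd).
    by apply: measurableT_comp => //; exact: measurable_colvec_coord.
  by apply/funext => p /=; rewrite /colvec_coord colvec_consS.
rewrite (_ : _ \o _ = fst)//.
by apply/funext => p /=; rewrite /colvec_coord colvec_cons0.
Qed.

Lemma measurable_colvec_uncons n : measurable_fun setT (@colvec_uncons n).
Proof.
apply: measurable_fun_pair; first exact: (measurable_colvec_coord ord0).
apply/measurable_fun_colvecP => i.
rewrite (_ : _ \o _ = colvec_coord (rshift 1 i : 'I_n.+1)).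
  exact: measurable_colvec_coord.
by apply/funext => v; rewrite /colvec_coord /= mxE.
Qed.

Section step.
Variables (n : nat) (mu : {sigma_finite_measure set 'cV[R]_n -> \bar R}).

Definition lebesgue_colvec_step : set 'cV[R]_n.+1 -> \bar R :=
  pushforward (lebesgue_measure \x mu)%E (@colvec_cons n).

Let step0 : lebesgue_colvec_step set0 = 0%E.
Proof. by rewrite /lebesgue_colvec_step /pushforward preimage_set0 measure0. Qed.

Let step_ge0 A : (0 <= lebesgue_colvec_step A)%E.
Proof. exact: (measure_ge0 (lebesgue_measure \x mu)%E). Qed.

Let step_sigma_additive : semi_sigma_additive lebesgue_colvec_step.
Proof.
move=> F mF tF mUF; rewrite /lebesgue_colvec_step /pushforward preimage_bigcup.
have mcons A : measurable A -> measurable (@colvec_cons n @^-1` A).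
  by move=> mA; rewrite -[X in measurable X]setTI; exact: measurable_colvec_cons.
apply: measure_semi_sigma_additive.
- by move=> k; exact: mcons.
- apply/trivIsetP => /= i j _ _ ij; rewrite -preimage_setI.
  by move/trivIsetP : tF => /(_ _ _ _ _ ij) ->//; rewrite preimage_set0.
- by rewrite -preimage_bigcup; exact: mcons.
Qed.

HB.instance Definition _ := isMeasure.Build _ _ _ lebesgue_colvec_step
  step0 step_ge0 step_sigma_additive.

Let step_sigma_finite : sigma_finite setT lebesgue_colvec_step.
Proof.
have /sigma_finiteP[F [TF ndF Foo]] :=
  sigma_finiteT (@lebesgue_measure R : {sigma_finite_measure set _ -> \bar R}).
have /sigma_finiteP[G [TG ndG Goo]] := sigma_finiteT mu.
exists (fun k => @colvec_uncons n @^-1` (F k `*` G k)).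
  rewrite -preimage_bigcup -[LHS](@preimage_setT _ _ (@colvec_uncons n)).
  congr (_ @^-1` _); rewrite -setXTT TF TG predeqE => -[x y]; split.
    move=> [/= [i _ Fix] [k _ Gky]]; exists (maxn i k) => //; split.
    - by move: x Fix; exact/subsetPset/ndF/leq_maxl.
    - by move: y Gky; exact/subsetPset/ndG/leq_maxr.
  by move=> [k _ []/= ? ?]; split; exists k.
move=> k; have [mFk Fk] := Foo k; have [mGk Gk] := Goo k; split.
  rewrite -[X in measurable X]setTI; apply: measurable_colvec_uncons => //.
  exact: measurableX.
rewrite /lebesgue_colvec_step /pushforward -comp_preimage.
rewrite (_ : _ \o _ = id) ?preimage_id; last first.
  by apply/funext => p /=; exact: colvec_consK.
by rewrite product_measure1E// lte_mul_pinfty// ge0_fin_numE.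
Qed.

HB.instance Definition _ := Measure_isSigmaFinite.Build _ _ _
  lebesgue_colvec_step step_sigma_finite.

End step.

(* m-dimensional Lebesgue measure, as an iterated product measure. *)
Fixpoint lebesgue_colvec m : {sigma_finite_measure set 'cV[R]_m -> \bar R} :=
  match m with
  | 0 => \d_(0 : 'cV[R]_0)
  | n.+1 => lebesgue_colvec_step (lebesgue_colvec n)
  end.

Lemma lebesgue_colvec_box m (B : 'I_m -> set (measurableTypeR R)) :
  (forall i, measurable (B i)) ->
  lebesgue_colvec m [set x | forall i, B i (x i 0)] =
  (\prod_(i < m) lebesgue_measure (B i))%E.
Proof.
elim: m B => [|n IHn] B mB.
  by rewrite big_ord0 /= diracE mem_set// => -[].
rewrite big_ord_recl -IHn; last by move=> i; exact: mB.
rewrite [LHS]/= /lebesgue_colvec_step /pushforward -product_measure1E//.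
  congr (product_measure1 _ _ _); apply/seteqP; split => -[x v] /=.
    by move=> H; split=> [|i]; [have := H 0; rewrite colvec_cons0|
      have := H (lift ord0 i); rewrite colvec_consS].
  move=> [Bx Bv] i; have [j ->|->] := unliftP ord0 i.
    by rewrite colvec_consS; exact: Bv.
  by rewrite colvec_cons0.
rewrite [X in measurable X](_ : _ =
  \bigcap_(i in [set: 'I_n]) (colvec_coord i @^-1` B (lift ord0 i))).
  apply: fin_bigcap_measurable => // i _.
  by rewrite -[X in measurable X]setTI; exact: measurable_colvec_coord.
by apply/seteqP; split => v /= H i; [move=> _|]; exact: H.
Qed.

End lebesgue_colvec.

Section norms.
Context {R : realType}.

Definition enorm m (v : 'cV[R]_m) : R := Num.sqrt (\sum_(i < m) v i 0 ^+ 2).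

Definition opnorm m n (A : 'M[R]_(m, n)) : R :=
  sup [set enorm (A *m v) | v in [set v : 'cV[R]_n | enorm v <= 1]].

(* Distance between the ranges of A and B, whose columns are orthonormal. *)
Definition dist_ran m n (A B : 'M[R]_(m, n)) : R :=
  opnorm (A *m A^T - B *m B^T).

(* Eigenvalues are numbered from 1, so that lam k is lambda_k for 1 <= k <= m;
   other values of lam are irrelevant. *)
Definition eigendecomposition m (C W : 'M[R]_m) (lam : nat -> R) : Prop :=
  [/\ W^T *m W = 1%:M,
      forall i j, (1 <= i)%N -> (i <= j)%N -> (j <= m)%N -> lam j <= lam i &
      C = W *m diag_mx (\row_(i < m) lam i.+1) *m W^T].

End norms.

Section functions_on_a_subset.
Context {R : realType} {m : nat}.
Implicit Types (X : set 'cV[R]_m) (f : 'cV[R]_m -> R) (x : 'cV[R]_m).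

(* A function X -> R is represented by f : R^m -> R whose values outside X are
   irrelevant: differentials are taken relative to X. *)
Definition differentiable_on X f : Prop :=
  forall x, X x -> differentiable f (within X (nbhs x)).

Definition gradient X f x : 'cV[R]_m :=
  \col_i ('d f (within X (nbhs x)) (delta_mx i 0) : R).

Definition absolutely_continuous_itv (a b : R) (g : R -> R) : Prop :=
  forall e : R, 0 < e -> exists2 d : R, 0 < d &
    forall (k : nat) (u v : 'I_k -> R),
      (forall i, a <= u i /\ u i <= v i /\ v i <= b) ->
      (forall i j, i != j -> v i <= u j \/ v j <= u i) ->
      \sum_(i < k) (v i - u i) < d ->
      \sum_(i < k) `|g (v i) - g (u i)| < e.

(* Absolute continuity of a function of several variables is understood along
   the line segments contained in X. *)
Definition absolutely_continuous_on X f : Prop :=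
  forall x y, (forall t : R, 0 <= t <= 1 -> X (x + t *: (y - x))) ->
    absolutely_continuous_itv 0 1 (fun t => f (x + t *: (y - x))).

(* Every coordinate has the same range, symmetric about 0; r may be +oo. *)
Definition centered_same_range X : Prop :=
  exists r : \bar R, forall i : 'I_m,
    ereal_sup [set (x i 0)%:E | x in X] = r /\
    ereal_inf [set (x i 0)%:E | x in X] = (- r)%E.

Definition separable (rho : 'cV[R]_m -> R) : Prop :=
  exists r : 'I_m -> R -> R, forall x, rho x = \prod_(i < m) r i (x i 0).

Definition density_on X (rho : 'cV[R]_m -> R) : Prop :=
  [/\ measurable_fun [set: 'cV[R]_m] rho,
      forall x, X x -> 0 < rho x,
      forall x, ~ X x -> rho x = 0,
      exists M : R, forall x, rho x <= M &
      (\int[lebesgue_colvec m]_x (rho x)%:E)%E = 1%E].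

(* Entrywise integral of F rho over X (rho vanishes outside X). *)
Definition integral_mx X (rho : 'cV[R]_m -> R) (F : 'cV[R]_m -> 'M[R]_m) : 'M[R]_m :=
  \matrix_(i, j) \int[lebesgue_colvec m]_(x in X) (F x i j * rho x).

Definition grad_outer X f x : 'M[R]_m := gradient X f x *m (gradient X f x)^T.

Definition gradient_cov X rho f : 'M[R]_m := integral_mx X rho (grad_outer X f).

Definition gradient_fluctuation X rho f : 'M[R]_m :=
  integral_mx X rho (fun x =>
    let D := grad_outer X f x - gradient_cov X rho f in D *m D).

Definition sample_gradient_cov X f N (xs : 'I_N -> 'cV[R]_m) : 'M[R]_m :=
  N%:R^-1 *: \sum_(j < N) grad_outer X f (xs j).

End functions_on_a_subset.

Section sampling.
Context {R : realType} {m N : nat} {d : measure_display} {T : measurableType d}.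
Context {P : probability T R}.

Definition has_density (rho : 'cV[R]_m -> R) (x : {RV P >-> 'cV[R]_m}) : Prop :=
  forall B, measurable B ->
    distribution P x B = (\int[lebesgue_colvec m]_(y in B) (rho y)%:E)%E.

(* Taking some of the B j to be the whole space gives the product rule for
   every subfamily. *)
Definition independent_samples (x : 'I_N -> {RV P >-> 'cV[R]_m}) : Prop :=
  forall B : 'I_N -> set 'cV[R]_m, (forall j, measurable (B j)) ->
    P (\bigcap_(j in [set: 'I_N]) (x j @^-1` B j)) =
    (\prod_(j < N) P (x j @^-1` B j))%E.

End sampling.

(* Main.v *)
Require Import Defs.
From HB Require Import structures.
From mathcomp Require Import all_boot all_order all_algebra.
From mathcomp Require Import all_classical all_reals all_analysis.
From mathcomp Require Import measurable_realfun ring lra.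
Set Implicit Arguments.
Unset Strict Implicit.
Unset Printing Implicit Defensive.
Import Order.TTheory GRing.Theory Num.Theory.
Import numFieldNormedType.Exports.
Import HBNNSimple.
Local Open Scope classical_set_scope.
Local Open Scope ring_scope.

(** Proof idea. Write Y = g g^T for g the gradient at a random point, so that
    C = E[Y] and the fluctuation matrix is V = E[(Y - C)^2].

    Golden-Thompson, tr e^(A+B) <= tr (e^A e^B), lets one peel off independent
    samples one by one from E tr e^(theta sum_j (Y_j - C)) and yields a matrix
    Bernstein inequality: with the stated number of samples, the operator norm
    of the error in C is at most lambda_1 eps with high probability. Matrix
    exponentials are replaced by (1 + M/K)^K with K a large power of 2, for
    which Golden-Thompson is, up to O(1/K), the inequality
    tr (PQ)^(2^k) <= tr (P^(2^k) Q^(2^k)) for symmetric P and Q; no spectral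
    theorem is needed. Weyl's inequality and the sin-theta argument of Davis
    and Kahan turn the operator norm error into a distance between ranges.

    Since X is only a measurable product set, the gradient relative to X is
    shown to be measurable off a Lebesgue-null union of countably many
    hyperplanes; the samples almost surely avoid it, and it does not affect the
    integrals defining C and V. *)

(** * Euclidean norms and operator bounds *)

Section euclidean.
Context {R : realType}.

(** Powers instead of exponentials keep every matrix entry polynomial in functions of single
    samples. Independence, given as a product rule for events, then only has to be extended to
    products of bounded functions, with no conditional expectation. The price is an error of order
    1/K at each of the N peeling steps; K is fixed after N, so these errors add up to at most the
    dimension and only double the trace bound.

    The upper bound on eps serves the perturbation step: eta = lambda_1 eps is at most a fifth of
    the gap, so Weyl leaves at least four fifths of it, and the sin-theta argument gives 5/4 eta
    over the gap, within the announced factor 4. The number of samples enters through the exponent N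
    eta / (4 e delta), which has to exceed a multiple of log(2m) depending on beta. *)

Definition dot m (u v : 'cV[R]_m) : R := (u^T *m v) 0 0.

Lemma dotE m (u v : 'cV[R]_m) : dot u v = \sum_i u i 0 * v i 0.
Proof. by rewrite /dot mxE; apply: eq_bigr => i _; rewrite mxE. Qed.

Lemma dotC m (u v : 'cV[R]_m) : dot u v = dot v u.
Proof. by rewrite !dotE; apply: eq_bigr => i _; rewrite mulrC. Qed.

Lemma dotDl m (u v w : 'cV[R]_m) : dot (u + v) w = dot u w + dot v w.
Proof. by rewrite /dot linearD mulmxDl mxE. Qed.

Lemma dotDr m (u v w : 'cV[R]_m) : dot u (v + w) = dot u v + dot u w.
Proof. by rewrite /dot mulmxDr mxE. Qed.

Lemma dotZl m a (u v : 'cV[R]_m) : dot (a *: u) v = a * dot u v.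
Proof. by rewrite /dot linearZ -scalemxAl mxE. Qed.

Lemma dotZr m a (u v : 'cV[R]_m) : dot u (a *: v) = a * dot u v.
Proof. by rewrite /dot -scalemxAr mxE. Qed.

Lemma dotNl m (u v : 'cV[R]_m) : dot (- u) v = - dot u v.
Proof. by rewrite -scaleN1r dotZl mulN1r. Qed.

Lemma dotNr m (u v : 'cV[R]_m) : dot u (- v) = - dot u v.
Proof. by rewrite -scaleN1r dotZr mulN1r. Qed.

Lemma dotBl m (u v w : 'cV[R]_m) : dot (u - v) w = dot u w - dot v w.
Proof. by rewrite dotDl dotNl. Qed.

Lemma dotBr m (u v w : 'cV[R]_m) : dot u (v - w) = dot u v - dot u w.
Proof. by rewrite dotDr dotNr. Qed.

Lemma dot0l m (v : 'cV[R]_m) : dot 0 v = 0.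
Proof. by rewrite /dot trmx0 mul0mx mxE. Qed.

Lemma dot_suml m (I : Type) (s : seq I) (Q : pred I) (F : I -> 'cV[R]_m) v :
  dot (\sum_(i <- s | Q i) F i) v = \sum_(i <- s | Q i) dot (F i) v.
Proof.
elim/big_ind2 : _ => [|x1 x2 y1 y2 <- <-|//]; first exact: dot0l.
exact: dotDl.
Qed.

Lemma dot_ge0 m (v : 'cV[R]_m) : 0 <= dot v v.
Proof. by rewrite dotE sumr_ge0// => i _; rewrite -expr2 sqr_ge0. Qed.

Lemma dot_eq0 m (v : 'cV[R]_m) : (dot v v == 0) = (v == 0).
Proof.
rewrite dotE psumr_eq0; last by move=> i _; rewrite -expr2 sqr_ge0.
apply/allP/eqP => [h|-> i _]; last by rewrite /= mxE mulr0.
apply/matrixP => i j; rewrite ord1 mxE; apply/eqP.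
by have := h i (mem_index_enum _); rewrite /= mulf_eq0 orbb.
Qed.

Lemma dot_mulmxl m n (A : 'M[R]_(n, m)) u (v : 'cV[R]_n) :
  dot (A *m u) v = dot u (A^T *m v).
Proof. by rewrite /dot trmx_mul mulmxA. Qed.

Lemma dot_mulmxr m n (A : 'M[R]_(n, m)) (u : 'cV[R]_n) v :
  dot u (A *m v) = dot (A^T *m u) v.
Proof. by rewrite dot_mulmxl trmxK. Qed.

Lemma dot_delta m n (A : 'M[R]_(m, n)) i j :
  dot (delta_mx i 0) (A *m delta_mx j 0) = A i j.
Proof. by rewrite /dot trmx_delta -colE -rowE !mxE. Qed.

Lemma enormE m (v : 'cV[R]_m) : enorm v = Num.sqrt (dot v v).
Proof. by rewrite /enorm dotE; congr Num.sqrt; apply: eq_bigr. Qed.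

Lemma enorm_ge0 m (v : 'cV[R]_m) : 0 <= enorm v.
Proof. exact: sqrtr_ge0. Qed.

Lemma sqr_enorm m (v : 'cV[R]_m) : enorm v ^+ 2 = dot v v.
Proof. by rewrite enormE sqr_sqrtr ?dot_ge0. Qed.

Lemma enorm0 m : enorm (0 : 'cV[R]_m) = 0.
Proof. by rewrite enormE dot0l sqrtr0. Qed.

Lemma enorm_eq0 m (v : 'cV[R]_m) : (enorm v == 0) = (v == 0).
Proof. by rewrite -dot_eq0 -sqr_enorm sqrf_eq0. Qed.

Lemma enormZ m a (v : 'cV[R]_m) : enorm (a *: v) = `|a| * enorm v.
Proof.
by rewrite !enormE dotZl dotZr mulrA -expr2 sqrtrM ?sqr_ge0// sqrtr_sqr.
Qed.

Lemma enorm_le m n (u : 'cV[R]_m) (v : 'cV[R]_n) a : 0 <= a ->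
  (enorm u <= a * enorm v) = (dot u u <= a ^+ 2 * dot v v).
Proof.
move=> a0; rewrite -!sqr_enorm -exprMn ler_sqr// nnegrE ?enorm_ge0//.
by rewrite mulr_ge0 ?enorm_ge0.
Qed.

Lemma cauchy_schwarz_sqr m (u v : 'cV[R]_m) :
  dot u v ^+ 2 <= dot u u * dot v v.
Proof.
have [->|u0] := eqVneq u 0; first by rewrite !dot0l expr0n mul0r.
have uu : 0 < dot u u by rewrite lt_neqAle eq_sym dot_eq0 u0 dot_ge0.
have := dot_ge0 (dot u u *: v - dot u v *: u).
rewrite !(dotBl, dotBr, dotZl, dotZr) (dotC v u).
have -> : dot u u * (dot u u * dot v v - dot u v * dot u v) -
  dot u v * (dot u u * dot u v - dot u v * dot u u) =
  dot u u * (dot u u * dot v v - dot u v ^+ 2) by ring.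
by rewrite pmulr_rge0// subr_ge0.
Qed.

Lemma cauchy_schwarz m (u v : 'cV[R]_m) : `|dot u v| <= enorm u * enorm v.
Proof.
rewrite -ler_sqr ?nnegrE ?mulr_ge0 ?enorm_ge0//.
by rewrite exprMn !sqr_enorm real_normK ?num_real// cauchy_schwarz_sqr.
Qed.

Lemma ler_enormD m (u v : 'cV[R]_m) : enorm (u + v) <= enorm u + enorm v.
Proof.
rewrite -ler_sqr ?nnegrE ?addr_ge0 ?enorm_ge0//.
rewrite sqrrD !sqr_enorm !(dotDl, dotDr) (dotC v u).
have := le_trans (ler_norm _) (cauchy_schwarz u v); lra.
Qed.

(** Preferred to [opnorm] because it passes through sums, products and powers without handling a
    supremum. *)
Definition opbound m n (A : 'M[R]_(m, n)) (b : R) : Prop :=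
  forall v, enorm (A *m v) <= b * enorm v.

Lemma opbound_le m n (A : 'M[R]_(m, n)) a b : a <= b -> opbound A a -> opbound A b.
Proof.
by move=> ab h v; apply: (le_trans (h v)); rewrite ler_wpM2r ?enorm_ge0.
Qed.

Lemma opboundM m n p (A : 'M[R]_(m, n)) (B : 'M[R]_(n, p)) a b : 0 <= a ->
  opbound A a -> opbound B b -> opbound (A *m B) (a * b).
Proof.
move=> a0 hA hB v; rewrite -mulmxA; apply: (le_trans (hA _)).
by rewrite -mulrA ler_wpM2l.
Qed.

Lemma opboundD m n (A B : 'M[R]_(m, n)) a b :
  opbound A a -> opbound B b -> opbound (A + B) (a + b).
Proof.
move=> hA hB v; rewrite mulmxDl mulrDl; apply: (le_trans (ler_enormD _ _)).
exact: lerD.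
Qed.

Lemma opbound0 m n : opbound (0 : 'M[R]_(m, n)) 0.
Proof. by move=> v; rewrite mul0mx enorm0 mul0r. Qed.

Lemma opbound1 m : opbound (1%:M : 'M[R]_m) 1.
Proof. by move=> v; rewrite mul1mx mul1r. Qed.

Lemma opboundZ m n (A : 'M[R]_(m, n)) a b :
  opbound A b -> opbound (a *: A) (`|a| * b).
Proof.
by move=> h v; rewrite -scalemxAl enormZ -mulrA ler_wpM2l.
Qed.

Lemma opbound_sum m n (I : Type) (s : seq I) (F : I -> 'M[R]_(m, n)) b :
  (forall i, opbound (F i) b) -> opbound (\sum_(i <- s) F i) ((size s)%:R * b).
Proof.
move=> h; elim: s => [|i s IH]; first by rewrite big_nil mul0r; exact: opbound0.
by rewrite big_cons /= -natr1 addrC mulrDl mul1r; apply: opboundD.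
Qed.

Lemma opboundX m (A : 'M[R]_m) a k : 0 <= a -> opbound A a ->
  opbound (A ^+ k) (a ^+ k).
Proof.
move=> a0 h; elim: k => [|k IH]; first exact: opbound1.
by rewrite !exprS; exact: opboundM.
Qed.

Lemma opbound_dot m n (A : 'M[R]_(m, n)) b : 0 <= b ->
  (forall u v, dot u (A *m v) <= b * (enorm u * enorm v)) -> opbound A b.
Proof.
move=> b0 h v; have := h (A *m v) v; rewrite -sqr_enorm expr2 mulrCA.
have := enorm_ge0 (A *m v); rewrite le_eqVlt => /predU1P[<- _|Av].
  by rewrite mulr_ge0 ?enorm_ge0.
by rewrite ler_pM2l.
Qed.

Lemma sym_opbound m (A : 'M[R]_m) b : 0 <= b -> A^T = A ->
  (forall v, `|dot v (A *m v)| <= b * dot v v) -> opbound A b.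
Proof.
move=> b0 sA h; apply: opbound_dot => // u v.
have [->|u0] := eqVneq u 0; first by rewrite dot0l enorm0 mul0r mulr0.
have [->|v0] := eqVneq v 0.
  by rewrite mulmx0 dotC dot0l enorm0 !mulr0.
have nu : 0 < enorm u by rewrite lt_neqAle eq_sym enorm_eq0 u0 enorm_ge0.
have nv : 0 < enorm v by rewrite lt_neqAle eq_sym enorm_eq0 v0 enorm_ge0.
(* polarization, for vectors rescaled to have the same norm *)
pose x := enorm v *: u; pose y := enorm u *: v.
have xx : dot x x = (enorm u * enorm v) ^+ 2.
  by rewrite /x dotZl dotZr -sqr_enorm; ring.
have yy : dot y y = (enorm u * enorm v) ^+ 2.
  by rewrite /y dotZl dotZr -sqr_enorm; ring.
have yx : dot y (A *m x) = dot x (A *m y) by rewrite dot_mulmxr sA dotC.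
have h1 := le_trans (ler_norm _) (h (x + y)).
have h3 := h (x - y); move: h3; rewrite ler_norml => /andP[h3 _].
move: h1 h3.
rewrite !mulmxDr mulmxN !(dotDl, dotDr, dotNl, dotNr) yx (dotC y x) xx yy => h1 h3.
have : dot x (A *m y) <= b * (enorm u * enorm v) ^+ 2 by lra.
rewrite /x /y -scalemxAr dotZl dotZr mulrA (mulrC (enorm v)).
have -> : b * (enorm u * enorm v) ^+ 2 = enorm u * enorm v *
  (b * (enorm u * enorm v)) by ring.
by rewrite ler_pM2l// mulr_gt0.
Qed.

Lemma opnorm_le m n (A : 'M[R]_(m, n)) b : 0 <= b -> opbound A b -> opnorm A <= b.
Proof.
move=> b0 h; apply: ge_sup.
  by exists (enorm (A *m 0)), 0 => //=; rewrite enorm0 ler01.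
move=> _ [v /= v1 <-]; apply: le_trans (h v) _.
by rewrite -[leRHS]mulr1 ler_wpM2l.
Qed.

(** The constant is the Frobenius norm, by Cauchy-Schwarz on each row. It makes the supremum in
    [opnorm] finite, and bounds a quadratic form by a trace in [expr_quad_le_mxtrace]. *)
Lemma opbound_frobenius m n (A : 'M[R]_(m, n)) :
  opbound A (Num.sqrt (\sum_i dot (row i A)^T (row i A)^T)).
Proof.
move=> v; rewrite enorm_le ?sqrtr_ge0// sqr_sqrtr; last first.
  by rewrite sumr_ge0// => i _; exact: dot_ge0.
rewrite {1}dotE mulr_suml ler_sum// => i _.
have -> : (A *m v) i 0 = dot (row i A)^T v.
  by rewrite /dot trmxK -row_mul [RHS]mxE.
by rewrite -expr2 cauchy_schwarz_sqr.
Qed.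

Let opnorm_has_ub m n (A : 'M[R]_(m, n)) :
  has_ubound [set enorm (A *m v) | v in [set v : 'cV[R]_n | enorm v <= 1]].
Proof.
have hA := opbound_frobenius A.
exists (Num.sqrt (\sum_i dot (row i A)^T (row i A)^T)) => _ [u /= u1 <-].
by apply: le_trans (hA u) _; rewrite -[leRHS]mulr1 ler_wpM2l ?sqrtr_ge0.
Qed.

Lemma opnorm_ge0 m n (A : 'M[R]_(m, n)) : 0 <= opnorm A.
Proof.
apply: ub_le_sup; first exact: opnorm_has_ub.
by exists 0; rewrite /= ?mulmx0 enorm0.
Qed.

Lemma opbound_opnorm m n (A : 'M[R]_(m, n)) : opbound A (opnorm A).
Proof.
move=> v; have [->|v0] := eqVneq v 0; first by rewrite mulmx0 !enorm0 mulr0.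
have nv : 0 < enorm v by rewrite lt_neqAle eq_sym enorm_eq0 v0 enorm_ge0.
have -> : enorm (A *m v) = enorm (A *m ((enorm v)^-1 *: v)) * enorm v.
  rewrite -scalemxAr enormZ gtr0_norm ?invr_gt0// mulrAC mulVf ?mul1r//.
  by rewrite gt_eqF.
rewrite ler_pM2r//; apply: ub_le_sup; first exact: opnorm_has_ub.
exists ((enorm v)^-1 *: v) => //=.
by rewrite enormZ gtr0_norm ?invr_gt0// mulVf// gt_eqF.
Qed.

Lemma trace_opbound m (A : 'M[R]_m) b : opbound A b -> `|\tr A| <= m%:R * b.
Proof.
move=> h; apply: le_trans (ler_norm_sum _ _ _) _.
rewrite -[m in leRHS]card_ord mulr_natl -sumr_const ler_sum// => i _.
rewrite -dot_delta; apply: le_trans (cauchy_schwarz _ _) _.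
have e1 : enorm (delta_mx i 0 : 'cV[R]_m) = 1.
  rewrite enormE -[X in dot _ X]mul1mx dot_delta mxE eqxx sqrtr1//.
by rewrite e1 mul1r (le_trans (h _))// e1 mulr1.
Qed.

(** * The trace form of Golden-Thompson *)

Lemma trmxX m (A : 'M[R]_m) k : (A ^+ k)^T = A^T ^+ k.
Proof.
elim: k => [|k IH]; first by rewrite !expr0 trmx1.
by rewrite exprSr exprS trmx_mul IH.
Qed.

(** Both powers alternate [A] and [B], so a cyclic shift relates them. At exponent zero the traces
    would be [m] and [n], hence [k.+1]. *)
Lemma mxtrace_mulmxXC m n (A : 'M[R]_(m, n)) (B : 'M[R]_(n, m)) k :
  \tr ((A *m B) ^+ k.+1) = \tr ((B *m A) ^+ k.+1).
Proof.
have h j : (A *m B) ^+ j *m A = A *m (B *m A) ^+ j.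
  elim: j => [|j IH]; first by rewrite !expr0 mul1mx mulmx1.
  by rewrite !exprS -!mulmxA IH !mulmxA.
by rewrite exprSr [_ * _]mulmxA h -mulmxA mxtrace_mulC -mulmxA -[_ *m _]exprSr.
Qed.

Lemma mxtrace_trmxM m n (A : 'M[R]_(m, n)) :
  \tr (A *m A^T) = \sum_i \sum_j A i j ^+ 2.
Proof.
by apply: eq_bigr => i _; rewrite mxE; apply: eq_bigr => j _; rewrite mxE.
Qed.

Lemma mxtrace_mul_le m (A B : 'M[R]_m) :
  \tr (A *m B) <= (\tr (A *m A^T) + \tr (B *m B^T)) / 2.
Proof.
have -> : \tr (B *m B^T) = \tr (B^T *m B^T^T) by rewrite trmxK mxtrace_mulC.
rewrite !mxtrace_trmxM ler_pdivlMr// mulr_suml -big_split ler_sum//= => i _.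
rewrite mxE mulr_suml -big_split ler_sum//= => j _; rewrite mxE.
have := sqr_ge0 (A i j - B j i); nra.
Qed.

(* The two inequalities feed each other: [Z = P *m Q] in the second one gives
   the first one for [P *m P] and [Q *m Q], while [Z *m Z] in the second one
   leads to the first one for [Z^T *m Z] and [Z *m Z^T]. *)
Lemma golden_thompson_aux m k :
  (forall P Q : 'M[R]_m, P^T = P -> Q^T = Q ->
    \tr ((P *m Q) ^+ (2 ^ k)) <= \tr (P ^+ (2 ^ k) *m Q ^+ (2 ^ k))) /\
  (forall Z : 'M[R]_m, \tr (Z ^+ (2 ^ k.+1)) <= \tr ((Z *m Z^T) ^+ (2 ^ k))).
Proof.
elim: k => [|k [GT G]].
  split=> [P Q _ _|Z]; first by rewrite expn0 !expr1.
  by rewrite expn1 expn0 expr1 expr2; have := mxtrace_mul_le Z Z; lra.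
have sq (A : 'M[R]_m) : A ^+ (2 ^ k.+1) = (A *m A) ^+ (2 ^ k).
  by rewrite expnS exprM expr2.
split=> [P Q sP sQ|Z].
  apply: le_trans (G (P *m Q)) _; rewrite trmx_mul sP sQ.
  have -> : \tr ((P *m Q *m (Q *m P)) ^+ (2 ^ k)) =
      \tr (((P *m P) *m (Q *m Q)) ^+ (2 ^ k)).
    rewrite -(prednK (expn_gt0 2 k)) [in LHS]mulmxA mxtrace_mulmxXC.
    by rewrite !mulmxA.
  by rewrite !sq; apply: GT; rewrite trmx_mul ?sP ?sQ.
rewrite expnS exprM expr2; apply: le_trans (G _) _.
pose P := Z^T *m Z; pose Q := Z *m Z^T.
have sP : P^T = P by rewrite /P trmx_mul trmxK.
have sQ : Q^T = Q by rewrite /Q trmx_mul trmxK.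
have -> : \tr ((Z *m Z *m (Z *m Z)^T) ^+ (2 ^ k)) = \tr ((P *m Q) ^+ (2 ^ k)).
  rewrite -(prednK (expn_gt0 2 k)) trmx_mul [in LHS]mulmxA mxtrace_mulmxXC.
  by rewrite /P /Q !mulmxA.
apply: le_trans (GT _ _ sP sQ) _; apply: le_trans (mxtrace_mul_le _ _) _.
rewrite !trmxX sP sQ -![_ *m _]expr2 -!exprM -expnSr.
have -> : \tr (P ^+ (2 ^ k.+1)) = \tr (Q ^+ (2 ^ k.+1)).
  by rewrite -(prednK (expn_gt0 2 k.+1)) mxtrace_mulmxXC.
by rewrite /Q; lra.
Qed.

Lemma mxtrace_golden_thompson m k (P Q : 'M[R]_m) : P^T = P -> Q^T = Q ->
  \tr ((P *m Q) ^+ (2 ^ k)) <= \tr (P ^+ (2 ^ k) *m Q ^+ (2 ^ k)).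
Proof. exact: (golden_thompson_aux m k).1. Qed.

End euclidean.

(** * Perturbation of spectral projections *)

Section spectral_calculus.
Context {R : realType} {m : nat}.
Implicit Types (W C : 'M[R]_m) (lam : nat -> R) (eta g : R)
  (phi psi : 'I_m -> R) (v : 'cV[R]_m).

(** Functional calculus in the eigenbasis [W]. The function is indexed by position and not by
    eigenvalue, so spectral projections make sense even with repeated eigenvalues. *)
Definition spec W phi : 'M[R]_m := W *m diag_mx (\row_i phi i) *m W^T.

Lemma eq_spec W phi psi : phi =1 psi -> spec W phi = spec W psi.
Proof. by move=> h; congr (_ *m diag_mx _ *m _); apply/rowP => i; rewrite !mxE. Qed.

Lemma tr_spec W phi : (spec W phi)^T = spec W phi.
Proof. by rewrite /spec !trmx_mul trmxK tr_diag_mx mulmxA. Qed.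

Lemma specD W phi psi : spec W phi + spec W psi = spec W (fun i => phi i + psi i).
Proof.
rewrite /spec -mulmxDl -mulmxDr -linearD/=; congr (_ *m diag_mx _ *m _).
by apply/rowP => i; rewrite !mxE.
Qed.

Lemma specN W phi : - spec W phi = spec W (fun i => - phi i).
Proof.
rewrite /spec -mulNmx -mulmxN -linearN/=; congr (_ *m diag_mx _ *m _).
by apply/rowP => i; rewrite !mxE.
Qed.

Lemma specM W phi psi : W^T *m W = 1%:M ->
  spec W phi *m spec W psi = spec W (fun i => phi i * psi i).
Proof.
move=> WW; rewrite /spec !mulmxA -(mulmxA _ W^T W) WW mulmx1.
rewrite -(mulmxA W) mulmx_diag; congr (_ *m diag_mx _ *m _).
by apply/rowP => i; rewrite !mxE.
Qed.

Lemma spec_cst W a : W^T *m W = 1%:M -> spec W (fun=> a) = a%:M.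
Proof.
move=> /mulmx1C WW; rewrite /spec.
have -> : diag_mx (\row__ a) = a%:M :> 'M[R]_m.
  by rewrite -diag_const_mx; congr diag_mx; apply/rowP => i; rewrite !mxE.
by rewrite mul_mx_scalar -scalemxAl WW scalemx1.
Qed.

Lemma tr_mulmx_dot W v : W^T *m W = 1%:M -> dot (W^T *m v) (W^T *m v) = dot v v.
Proof. by move=> /mulmx1C WW; rewrite dot_mulmxl trmxK mulmxA WW mul1mx. Qed.

Lemma dot_spec W phi v :
  dot v (spec W phi *m v) = \sum_i phi i * (W^T *m v) i 0 ^+ 2.
Proof.
rewrite /spec -!mulmxA dot_mulmxr dotE; apply: eq_bigr => i _.
by rewrite mul_diag_mx !mxE; ring.
Qed.

Lemma opbound_spec W phi b : W^T *m W = 1%:M -> 0 <= b ->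
  (forall i, `|phi i| <= b) -> opbound (spec W phi) b.
Proof.
move=> WW b0 h; apply: sym_opbound => //; first exact: tr_spec.
move=> v; rewrite dot_spec -(tr_mulmx_dot v WW) dotE mulr_sumr.
apply: le_trans (ler_norm_sum _ _ _) _; apply: ler_sum => i _.
by rewrite normrM -expr2 (ger0_norm (sqr_ge0 _)) ler_wpM2r ?sqr_ge0.
Qed.

Definition lead_proj W n := spec W (fun i => (i < n)%:R).
Definition tail_proj W n := spec W (fun i => (n <= i)%:R).

Lemma tr_lead_proj W n : (lead_proj W n)^T = lead_proj W n.
Proof. exact: tr_spec. Qed.

Lemma tr_tail_proj W n : (tail_proj W n)^T = tail_proj W n.
Proof. exact: tr_spec. Qed.

Lemma lead_tail_proj W n : W^T *m W = 1%:M -> lead_proj W n + tail_proj W n = 1%:M.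
Proof.
move=> WW; rewrite specD -(spec_cst 1 WW); apply: eq_spec => i.
by case: ltnP; rewrite ?addr0 ?add0r.
Qed.

Lemma lead_proj_idem W n : W^T *m W = 1%:M ->
  lead_proj W n *m lead_proj W n = lead_proj W n.
Proof.
by move=> WW; rewrite specM//; apply: eq_spec => i; case: ltnP;
  rewrite ?mulr0 ?mul1r.
Qed.

Lemma tail_proj_idem W n : W^T *m W = 1%:M ->
  tail_proj W n *m tail_proj W n = tail_proj W n.
Proof.
by move=> WW; rewrite specM//; apply: eq_spec => i; case: leqP;
  rewrite ?mulr0 ?mul1r.
Qed.

Lemma dot_lead_tail W n v : W^T *m W = 1%:M ->
  dot (lead_proj W n *m v) (lead_proj W n *m v) +
  dot (tail_proj W n *m v) (tail_proj W n *m v) = dot v v.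
Proof.
move=> WW; rewrite !dot_mulmxl tr_lead_proj tr_tail_proj
  (mulmxA (lead_proj W n)) (mulmxA (tail_proj W n)) lead_proj_idem//
    tail_proj_idem//.
by rewrite -dotDr -mulmxDl lead_tail_proj// mul1mx.
Qed.

(** Turns the products inside [dist_ran] into spectral projections, to which the calculus of [spec]
    applies. *)
Lemma colsub_lead_proj W n (nm : (n <= m)%N) :
  colsub (widen_ord nm) W *m (colsub (widen_ord nm) W)^T = lead_proj W n.
Proof.
apply/matrixP => i j; rewrite /lead_proj /spec mul_mx_diag !mxE.
under eq_bigr do rewrite !mxE.
rewrite -(big_ord_narrow (F := fun k => W i k * W j k) nm) big_mkcond.
apply: eq_bigr => k _; rewrite !mxE.
by case: ltnP; rewrite ?mulr1 ?mulr0 ?mul0r.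
Qed.

(* Vectors in the span of the first [k] columns of [W] and of the last
   [m - k + 1] columns of [W'] are the kernel of [m - 1] linear forms. *)
Lemma exists_common_vector W W' k : (k < m)%N ->
  exists2 v : 'cV[R]_m, v != 0 &
    (forall i : 'I_m, (k < i)%N -> (W^T *m v) i 0 = 0) /\
    (forall i : 'I_m, (i < k)%N -> (W'^T *m v) i 0 = 0).
Proof.
move=> km; pose B : 'M[R]_m := \matrix_(i, j)
  (if (k < i)%N then W j i else if (i < k)%N then W' j i else 0).
(* Row [k] of [B] satisfies neither test and is zero, so [B] is singular. *)
have /eqP/det0P[v v0 vB] : \det B^T = 0.
  rewrite det_tr (expand_det_row _ (Ordinal km)) big1// => j _.
  by rewrite mxE /= ltnn mul0r.
exists v^T; first by rewrite trmx_eq0.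
have h i : (B *m v^T) i 0 = 0.
  by rewrite -[B]trmxK -trmx_mul vB !mxE.
split=> i ki; have := h i; rewrite !mxE => hi; rewrite -[RHS]hi;
  apply: eq_bigr => j _; rewrite !mxE.
  by rewrite ki.
by rewrite ltnNge (ltnW ki)/= ki.
Qed.

(** At a common vector of the first [k + 1] eigendirections of [C] and of those of [C'] from
    position [k] on, the Rayleigh quotient of [C] is at least [lam k.+1] and that of [C'] at most
    [lam' k.+1]; they differ by at most [eta]. *)
Lemma weyl C C' W W' lam lam' eta k : (k < m)%N -> 0 <= eta ->
  eigendecomposition C W lam -> eigendecomposition C' W' lam' ->
  opbound (C' - C) eta -> lam k.+1 <= lam' k.+1 + eta.
Proof.
move=> km eta0 [WW dec CE] [WW' dec' CE'] hE.
have [v v0 [h h']] := exists_common_vector W W' km.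
have vv : 0 < dot v v by rewrite lt_neqAle eq_sym dot_eq0 v0 dot_ge0.
rewrite -(ler_pM2r vv).
have h1 : lam k.+1 * dot v v <= dot v (C *m v).
  rewrite {1}CE dot_spec -(tr_mulmx_dot v WW) dotE mulr_sumr ler_sum// => i _.
  rewrite -expr2; case: (ltnP k i) => [ki|ik]; first by rewrite h// expr0n !mulr0.
  by rewrite ler_wpM2r ?sqr_ge0// dec.
have h2 : dot v (C' *m v) <= lam' k.+1 * dot v v.
  rewrite {1}CE' dot_spec -(tr_mulmx_dot v WW') dotE mulr_sumr ler_sum// => i _.
  rewrite -expr2; case: (ltnP i k) => [ki|ik]; first by rewrite h'// expr0n !mulr0.
  by rewrite ler_wpM2r ?sqr_ge0// dec'.
have h3 : `|dot v ((C' - C) *m v)| <= eta * dot v v.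
  apply: le_trans (cauchy_schwarz _ _) _.
  by rewrite -sqr_enorm expr2 mulrCA ler_wpM2l// enorm_ge0.
move: h3; rewrite ler_norml mulmxBl dotBr => /andP[h3 _]; nra.
Qed.

Lemma opbound_tr (A : 'M[R]_m) b : 0 <= b -> opbound A b -> opbound A^T b.
Proof.
move=> b0 h; apply: opbound_dot => // u v; rewrite dot_mulmxr trmxK.
apply: le_trans (ler_norm _) (le_trans (cauchy_schwarz _ _) _).
by rewrite mulrA ler_wpM2r ?enorm_ge0.
Qed.

(** A Sylvester equation for [Z = Q *m P']. The tail spectrum of [C] lies in the interval of centre
    [s] and radius [r], so [C - s] has norm at most [r] on the range of [Q]; the leading eigenvalues
    of [C'] exceed [s] by at least [r + g], so [J], the inverse of [C' - s] there, has norm at most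
    [(r + g)^-1]. Then [Z = Q (C' - C) J + T Z J] gives [z (r + g) <= eta + r z], that is
    [g z <= eta]. *)
Lemma opbound_tail_lead C C' W W' lam lam' eta g n : (0 < n)%N -> (n < m)%N ->
  0 <= eta -> 0 < g ->
  eigendecomposition C W lam -> eigendecomposition C' W' lam' ->
  opbound (C' - C) eta -> lam n.+1 + g <= lam' n ->
  opbound (tail_proj W n *m lead_proj W' n) (eta / g).
Proof.
move=> n0 nm eta0 g0 [WW dec CE] [WW' dec' CE'] hE hg.
set Q := tail_proj W n; set P' := lead_proj W' n.
pose s := (lam n.+1 + lam m) / 2; pose r := (lam n.+1 - lam m) / 2.
have r0 : 0 <= r by rewrite divr_ge0// subr_ge0 dec.
have rg : 0 < r + g by rewrite ltr_wpDl.
pose J := spec W' (fun i => (i < n)%:R / (lam' i.+1 - s)).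
have lam's (i : 'I_m) : (i < n)%N -> r + g <= lam' i.+1 - s.
  move=> im; have := dec' i.+1 n isT im (ltnW nm).
  by rewrite /r /s; lra.
have J_le : opbound J (r + g)^-1.
  apply: opbound_spec => //; first by rewrite invr_ge0 ltW.
  move=> i; case: ltnP => im; last by rewrite mul0r normr0 invr_ge0 ltW.
  have h := lam's i im; have h0 := lt_le_trans rg h.
  by rewrite mul1r gtr0_norm ?invr_gt0// lef_pV2.
have P'J : P' *m J = J.
  by rewrite specM//; apply: eq_spec => i; case: ltnP; rewrite ?mul1r// !mul0r.
have C'J : (C' - s%:M) *m J = P'.
  rewrite CE' -(spec_cst s WW') -/(spec _ (fun i => lam' i.+1)) specN specD specM//.
  apply: eq_spec => i; case: ltnP => im; last by rewrite mul0r mulr0.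
  have h : lam' i.+1 - s != 0 by rewrite gt_eqF// (lt_le_trans rg)// lam's.
  by rewrite mulrCA mulfV// mulr1.
pose T := spec W (fun i => (lam i.+1 - s) * (n <= i)%:R).
have QC : Q *m (C - s%:M) = T *m Q.
  rewrite CE -(spec_cst s WW) -/(spec _ (fun i => lam i.+1)) specN specD !specM//.
  by apply: eq_spec => i; case: leqP => _; rewrite ?mul1r ?mulr1// ?mul0r ?mulr0.
have T_le : opbound T r.
  apply: opbound_spec => // i; case: leqP => im; last by rewrite mulr0 normr0.
  rewrite mulr1 ler_norml.
  have := dec n.+1 i.+1 isT im (ltn_ord i);
    have := dec i.+1 m isT (ltn_ord i) (leqnn m).
  by rewrite /r /s => h1 h2; apply/andP; split; lra.
have Q1 : opbound Q 1.
  by apply: opbound_spec => // i; case: leqP => _; rewrite ?normr0 ?normr1.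
have QP' : Q *m P' = Q *m (C' - C) *m J + T *m (Q *m P') *m J.
  have -> : C' - C = (C' - s%:M) - (C - s%:M) by rewrite opprB addrA subrK.
  rewrite (mulmxBr Q) QC mulmxBl -(mulmxA Q _ J) C'J.
  by rewrite -(mulmxA T Q J) -(mulmxA T (Q *m P')) -(mulmxA Q P') P'J subrK.
set Z := Q *m P' in QP' *; set z := opnorm Z.
have z0 : 0 <= z by exact: opnorm_ge0.
have hz : opbound Z ((eta + r * z) / (r + g)).
  rewrite {1}QP' mulrDl; apply: opboundD; apply: opboundM => //.
  - by rewrite -(mul1r eta); apply: opboundM.
  - by rewrite mulr_ge0.
  - by apply: opboundM => //; exact: opbound_opnorm.
have : z <= (eta + r * z) / (r + g).
  by apply: opnorm_le hz; apply: divr_ge0;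
    [exact: addr_ge0 (mulr_ge0 _ _)|exact: ltW].
rewrite ler_pdivlMr// => hzz.
apply: opbound_le (opbound_opnorm Z).
rewrite -/z ler_pdivlMr//; nra.
Qed.

Lemma davis_kahan C C' W W' lam lam' eta n (nm : (n < m)%N) : (0 < n)%N ->
  eigendecomposition C W lam -> eigendecomposition C' W' lam' ->
  0 < lam n - lam n.+1 -> 0 <= eta -> 5 * eta <= lam n - lam n.+1 ->
  opbound (C' - C) eta ->
  dist_ran (colsub (widen_ord (ltnW nm)) W) (colsub (widen_ord (ltnW nm)) W') <=
    4 * eta / (lam n - lam n.+1).
Proof.
move=> n0 hC hC' gap0 eta0 gap hE; rewrite /dist_ran !colsub_lead_proj.
have hE' : opbound (C - C') eta.
  by move=> v; rewrite -opprB mulNmx -scaleN1r enormZ normrN1 mul1r.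
have nm1 : (n.-1 < m)%N by rewrite prednK// ltnW.
have w1 := weyl nm1 eta0 hC hC' hE; rewrite prednK// in w1.
have w2 := weyl nm eta0 hC' hC hE'.
(* Weyl moves [lam n] and [lam n.+1] by at most [eta <= G / 5], so four fifths of the gap separate
   the spectra in both applications below. *)
set G := lam n - lam n.+1 in gap0 gap *; pose g := G * (4 / 5).
have g0 : 0 < g by rewrite mulr_gt0.
have WW : W^T *m W = 1%:M by case: hC.
have WW' : W'^T *m W' = 1%:M by case: hC'.
have h1 : opbound (tail_proj W n *m lead_proj W' n) (eta / g).
  apply: (opbound_tail_lead n0 nm eta0 g0 hC hC' hE).
  by rewrite /g /G; move: gap; rewrite /G; lra.
have h2 : opbound (lead_proj W n *m tail_proj W' n) (eta / g).
  have -> : lead_proj W n *m tail_proj W' n = (tail_proj W' n *m lead_proj W n)^T.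
    by rewrite trmx_mul tr_lead_proj tr_tail_proj.
  apply: opbound_tr; first by rewrite divr_ge0// ltW.
  apply: (opbound_tail_lead n0 nm eta0 g0 hC' hC hE').
  by rewrite /g /G; move: gap; rewrite /G; lra.
have eg0 : 0 <= eta / g by rewrite divr_ge0// ltW.
have : opbound (lead_proj W n - lead_proj W' n) (eta / g).
  move=> v; rewrite enorm_le//.
  (* The two terms have orthogonal ranges, and they act on the orthogonal components [Q' v] and
     [P' v]. By Pythagoras their bounds do not add up: the difference inherits the common bound
     [eta / g]. *)
  have -> : lead_proj W n - lead_proj W' n =
      lead_proj W n *m tail_proj W' n *m tail_proj W' n -
      tail_proj W n *m lead_proj W' n *m lead_proj W' n.
    rewrite -(mulmxA _ (tail_proj W' n)) -(mulmxA _ (lead_proj W' n)).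
    rewrite lead_proj_idem// tail_proj_idem//.
    rewrite -[X in X - _]mulmx1 -(lead_tail_proj n WW') mulmxDr.
    rewrite -[X in _ - X]mul1mx -(lead_tail_proj n WW) mulmxDl.
    by rewrite opprD addrACA subrr add0r.
  set P := lead_proj W n; set Q := tail_proj W n.
  set P' := lead_proj W' n; set Q' := tail_proj W' n.
  rewrite mulmxBl -(mulmxA (P *m Q')) -(mulmxA (Q *m P'));
  set x := P *m Q' *m _; set y := Q *m P' *m _.
  have PQ : P *m Q = 0.
    rewrite specM// -[RHS](_ : spec W (fun=> 0) = _);
      last by rewrite spec_cst// raddf0.
    by apply: eq_spec => i; case: leqP; rewrite ?mulr0 ?mul0r.
  have xy : dot x y = 0.
    by rewrite /x /y -!(mulmxA _ _ (_ *m v)) dot_mulmxl tr_lead_proj (mulmxA P)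
      PQ mul0mx dotC dot0l.
  rewrite dotBl !dotBr xy (dotC y x) xy !(subr0, sub0r, opprK).
  rewrite -(dot_lead_tail n v WW') mulrDr addrC.
  by apply: lerD; rewrite -enorm_le//; [exact: h1|exact: h2].
move=> /(opnorm_le eg0) /le_trans; apply.
have -> : 4 * eta / G = 16 / 5 * (eta / g).
  by rewrite /g; field; rewrite gt_eqF.
nra.
Qed.

End spectral_calculus.

(** * Traces of powers *)

Section traces.
Context {R : realType}.

Lemma opbound_exprB m (U V : 'M[R]_m) r d k : 1 <= r -> 0 <= d ->
  opbound U r -> opbound V r -> opbound (U - V) d ->
  opbound (U ^+ k - V ^+ k) (k%:R * d * r ^+ k).
Proof.
move=> r1 d0 hU hV hUV; have r0 : 0 <= r by apply: le_trans r1.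
elim: k => [|k IH]; first by rewrite subrr !mul0r; exact: opbound0.
have -> : U ^+ k.+1 - V ^+ k.+1 = U ^+ k *m (U - V) + (U ^+ k - V ^+ k) *m V.
  by rewrite mulmxBr mulmxBl !exprSr addrA subrK.
have kdr : 0 <= k%:R * d * r ^+ k by rewrite !mulr_ge0// exprn_ge0.
apply: opbound_le (opboundD (opboundM _ (opboundX _ r0 hU) hUV)
  (opboundM kdr IH hV)).
  have : 0 <= d * r ^+ k by rewrite mulr_ge0 ?exprn_ge0.
  rewrite exprSr -natr1 => h; nra.
exact: exprn_ge0.
Qed.

(** Stands in for the bound of the largest eigenvalue by the trace. Cauchy-Schwarz at the unit
    vector [v] doubles the exponent at each step; the exponent being even, the power is [A *m A^T]
    and its trace is a squared Frobenius norm. *)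
Lemma expr_quad_le_mxtrace m (M : 'M[R]_m) v k : M^T = M -> dot v v = 1 ->
  0 <= dot v (M *m v) ->
  dot v (M *m v) ^+ (2 ^ k.+1) <= \tr (M ^+ (2 ^ k.+1)).
Proof.
move=> sM v1 M0.
have sX j : dot v (M ^+ (2 ^ j.+1) *m v) =
    dot (M ^+ (2 ^ j) *m v) (M ^+ (2 ^ j) *m v).
  rewrite expnSr exprM expr2 -[(_ * _) *m v]mulmxA dot_mulmxr trmxX sM.
  by [].
have h j : dot v (M *m v) ^+ (2 ^ j) <= dot v (M ^+ (2 ^ j) *m v).
  elim: j => [|j IH]; first by rewrite expn0 !expr1.
  rewrite sX expnSr exprM.
  apply: (@le_trans _ _ (dot v (M ^+ (2 ^ j) *m v) ^+ 2)).
    rewrite ler_sqr ?nnegrE ?exprn_ge0//.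
    by apply: le_trans IH; rewrite exprn_ge0.
  by apply: le_trans (cauchy_schwarz_sqr _ _) _; rewrite v1 mul1r.
apply: le_trans (h _) _; rewrite sX; set A := M ^+ (2 ^ k).
have -> : M ^+ (2 ^ k.+1) = A *m A^T by rewrite /A trmxX sM expnSr exprM expr2.
have := opbound_frobenius A v; rewrite enorm_le ?sqrtr_ge0// v1 mulr1.
rewrite sqr_sqrtr ?sumr_ge0// => [/le_trans->//|i _]; last exact: dot_ge0.
rewrite ler_sum// => i _; rewrite mxE dotE ler_sum// => j _.
by rewrite !mxE.
Qed.

(** By cyclicity the trace of [M M E] is that of [M E M], a sum of values of the quadratic form of
    [E] at the columns of [M]. *)
Lemma mxtrace_mul_quad_le m (M E : 'M[R]_m) b : M^T = M ->
  (forall v, dot v (E *m v) <= b * dot v v) ->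
  \tr (M *m M *m E) <= b * \tr (M *m M).
Proof.
move=> sM h; rewrite -mulmxA mxtrace_mulC mulr_sumr ler_sum// => i _.
rewrite -!dot_delta -!mulmxA.
by rewrite (dot_mulmxr M) [X in _ * X](dot_mulmxr M) sM; apply: h.
Qed.

Lemma exprD1V_le (a : R) K : 0 <= a -> (1 + K%:R^-1 * a) ^+ K <= expR a.
Proof.
move=> a0; case: K => [|K]; first by rewrite expr0 -expR0 ler_expR.
have -> : expR a = expR (K.+1%:R^-1 * a) ^+ K.+1.
  by rewrite -expRM_natl mulrA divff ?mul1r// pnatr_eq0.
by rewrite lerXn2r ?nnegrE ?expR_ge0 ?expR_ge1Dx ?addr_ge0 ?mulr_ge0 ?invr_ge0.
Qed.

(** Matrix version of e^x <= 1 + x + e x^2 for |x| <= 1. In the binomial expansion each term of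
    degree at least two is bounded by its coefficient times the squared norm of [X *m v], and these
    coefficients sum to at most (1 + 1/K)^K <= e. *)
Lemma quad_expr_le m (X : 'M[R]_m) K v : (0 < K)%N -> X^T = X -> opbound X 1 ->
  dot v ((1 + K%:R^-1 *: X) ^+ K *m v) <=
    dot v v + dot v (X *m v) + expR 1 * dot (X *m v) (X *m v).
Proof.
case: K => // K _ sX X1; set a := K.+1%:R^-1; set q := dot (X *m v) _.
have a0 : 0 <= a by rewrite invr_ge0.
have q0 : 0 <= q by exact: dot_ge0.
have term (i : nat) : dot v ((a *: X) ^+ i *+ 'C(K.+1, i) *m v) =
    'C(K.+1, i)%:R * a ^+ i * dot v (X ^+ i *m v).
  have -> : (a *: X) ^+ i = a ^+ i *: X ^+ i.
    elim: i => [|i IH]; first by rewrite !expr0 scale1r.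
    by rewrite !exprS IH -[_ * _]scalemxAl -scalemxAr scalerA.
  by rewrite -scaler_nat scalerA -scalemxAl dotZr.
have -> : dot v ((1 + a *: X) ^+ K.+1 *m v) =
    \sum_(i < K.+2) 'C(K.+1, i)%:R * a ^+ i * dot v (X ^+ i *m v).
  rewrite addrC exprD1n mulmx_suml dotC dot_suml; apply: eq_bigr => i _.
  by rewrite dotC term.
rewrite !big_ord_recl /= bin0 bin1 expr0 expr1 !mul1r mulfV ?pnatr_eq0// mul1r.
rewrite mul1mx addrA lerD2l.
apply: (@le_trans _ _ ((1 + a * 1) ^+ K.+1 * q)); last first.
  by rewrite ler_wpM2r// exprD1V_le.
rewrite mulr1 addrC exprD1n !big_ord_recl/= mulrDl mulrDl addrA mulr_suml.
apply: ler_wpDl.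
  by rewrite addr_ge0 ?mulr_ge0 ?mulrn_wge0 ?exprn_ge0.
rewrite ler_sum// => i _; rewrite /bump/= !add1n -[X in _ <= X * _]mulr_natl.
apply: ler_wpM2l; first by rewrite mulr_ge0// (exprn_ge0 i.+2).
rewrite exprSr exprS -[_ *m v]mulmxA -[_ *m (X *m v)]mulmxA dot_mulmxr sX.
apply: le_trans (ler_norm _) (le_trans (cauchy_schwarz _ _) _).
rewrite /q -sqr_enorm expr2 ler_wpM2l ?enorm_ge0//.
by have := opboundX i ler01 X1 (X *m v); rewrite expr1n mul1r.
Qed.

(** Golden-Thompson applies to the product [(1 + a S) (1 + a X)], which differs from [1 + a (S + X)]
    by [a^2 S X] only. Raising to the power [K] multiplies this by about [K], leaving an error of
    order [1/K]. *)
Lemma mxtrace_expr_step m k (S X : 'M[R]_m) s : S^T = S -> X^T = X -> 0 <= s ->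
  opbound S s -> opbound X 1 ->
  \tr ((1 + (2 ^ k)%:R^-1 *: (S + X)) ^+ (2 ^ k)) <=
  \tr ((1 + (2 ^ k)%:R^-1 *: S) ^+ (2 ^ k) *m
       (1 + (2 ^ k)%:R^-1 *: X) ^+ (2 ^ k))
    + m%:R * (s * expR (2 * s + 1)) / (2 ^ k)%:R.
Proof.
move=> sS sX s0 hS hX; set K := (2 ^ k)%N; set a := K%:R^-1.
have K0 : (0 < K)%N by rewrite expn_gt0.
have a0 : 0 <= a by rewrite invr_ge0.
have a1 : a <= 1 by rewrite invf_le1 ?ltr0n// ler1n.
set U := 1 + _; set V := (1 + a *: S) *m (1 + a *: X).
have GT : \tr (V ^+ K) <= \tr ((1 + a *: S) ^+ K *m (1 + a *: X) ^+ K).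
  by apply: mxtrace_golden_thompson; rewrite linearD/= linearZ/= trmx1 ?sS ?sX.
(* Since [a <= 1], [r] dominates both [1 + a * (s + 1)] and [(1 + a * s) * (1 + a)]; its [K]-th
   power stays below [expR (2 * s + 1)]. *)
pose r := 1 + a * (2 * s + 1).
have hP1 (Y : 'M[R]_m) y : opbound Y y -> opbound (1 + a *: Y) (1 + a * y).
  by move=> hY; apply: opboundD (@opbound1 _ m) _; rewrite -{2}(ger0_norm a0);
    exact: opboundZ.
have hU : opbound U r.
  by apply: opbound_le (hP1 _ _ (opboundD hS hX));
    rewrite /r lerD2l ler_wpM2l//; lra.
have as0 : 0 <= a * s by rewrite mulr_ge0.
have hV : opbound V r.
  apply: opbound_le (opboundM _ (hP1 _ _ hS) (hP1 _ _ hX));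
    last by rewrite addr_ge0.
  by rewrite /r; nra.
have hUV : opbound (U - V) (a * a * s).
  have -> : U - V = (- (a * a)) *: (S *m X).
    rewrite /U /V mulmxDl !mulmxDr !mul1mx mulmx1 -scalemxAl -scalemxAr scalerA.
    by rewrite scalerDr scaleNr (addrACA 1) !addrA opprD addrA subrr sub0r.
  by have := opboundZ (- (a * a)) (opboundM s0 hS hX);
    rewrite normrN ger0_norm ?mulr_ge0// mulr1.
rewrite -lerBlDl; apply: le_trans (lerB (lexx _) GT) _.
have r1 : 1 <= r by rewrite lerDl mulr_ge0// addr_ge0// mulr_ge0.
rewrite -raddfB; apply: le_trans (ler_norm _) _.
apply: le_trans (trace_opbound (opbound_exprB K r1 _ hU hV hUV)) _.
  by rewrite !mulr_ge0.
rewrite -[leRHS]mulrA ler_wpM2l//.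
have -> : K%:R * (a * a * s) = s * a by rewrite !mulrA /a mulfV ?mul1r 1?mulrC//
  pnatr_eq0 -lt0n.
rewrite mulrAC ler_wpM2r// ler_wpM2l// exprD1V_le//.
by rewrite addr_ge0// mulr_ge0.
Qed.

End traces.

(** * Bounded measurable functions *)

Section bounded_measurable.
Context {R : realType} d {T : measurableType d}.
Implicit Types (f g : T -> R).

Definition bdd_meas f : Prop :=
  measurable_fun setT f /\ exists M : R, forall x, `|f x| <= M.

Lemma bdd_meas_cst a : bdd_meas (fun=> a).
Proof. by split; [exact: measurable_cst | exists `|a|]. Qed.

Lemma bdd_measD f g : bdd_meas f -> bdd_meas g -> bdd_meas (fun x => f x + g x).
Proof.
move=> [mf [M hM]] [mg [M' hM']]; split; first exact: measurable_funD.
by exists (M + M') => x; rewrite (le_trans (ler_normD _ _))// lerD.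
Qed.

Lemma bdd_measM f g : bdd_meas f -> bdd_meas g -> bdd_meas (fun x => f x * g x).
Proof.
move=> [mf [M hM]] [mg [M' hM']]; split; first exact: measurable_funM.
by exists (M * M') => x; rewrite normrM ler_pM.
Qed.

Lemma bdd_measZ a f : bdd_meas f -> bdd_meas (fun x => a * f x).
Proof. by apply: bdd_measM; exact: bdd_meas_cst. Qed.

Lemma bdd_meas_sum I (s : seq I) (F : I -> T -> R) :
  (forall i, bdd_meas (F i)) -> bdd_meas (fun x => \sum_(i <- s) F i x).
Proof.
move=> h; elim: s => [|i s IH].
  by under eq_fun do rewrite big_nil; exact: bdd_meas_cst.
by under eq_fun do rewrite big_cons; exact: bdd_measD.
Qed.

Lemma bdd_meas_prod I (s : seq I) (F : I -> T -> R) :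
  (forall i, bdd_meas (F i)) -> bdd_meas (fun x => \prod_(i <- s) F i x).
Proof.
move=> h; elim: s => [|i s IH].
  by under eq_fun do rewrite big_nil; exact: bdd_meas_cst.
by under eq_fun do rewrite big_cons; exact: bdd_measM.
Qed.

Lemma bdd_meas_indic (B : set T) : measurable B -> bdd_meas (\1_B : T -> R).
Proof.
move=> mB; split; first exact: measurable_indic.
by exists 1 => x; rewrite indicE; case: (_ \in _); rewrite ?normr1 ?normr0.
Qed.

Lemma bdd_meas_comp d' (U : measurableType d') (X : U -> T) f :
  measurable_fun setT X -> bdd_meas f ->
  measurable_fun setT (fun w => f (X w)) /\ exists M : R, forall w, `|f (X w)| <= M.
Proof.
move=> mX [mf [M hM]]; split; last by exists M => w.
exact: (measurableT_comp mf mX).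
Qed.

Let count_le (y : R) L : 0 <= y ->
  \sum_(i < L) (i.+1%:R <= y)%R%:R <= y :> R.
Proof.
move=> y0; elim: L => [|L IH]; first by rewrite big_ord0.
have [Ly|yL] := leP L.+1%:R y.
  apply: le_trans Ly; rewrite -[L.+1 in leRHS]card_ord -sumr_const ler_sum// => i _.
  by rewrite lern1 leq_b1.
by rewrite big_ord_recr /= [L.+1%:R <= y]leNgt yL addr0.
Qed.

Let count_ge (y : R) L : 0 <= y -> y <= L%:R ->
  y - 1 <= \sum_(i < L) (i.+1%:R <= y)%R%:R :> R.
Proof.
move=> y0; elim: L => [|L IH] yL; first by rewrite big_ord0 subr_le0 (le_trans yL).
have [Ly|{}Ly] := leP y L%:R.
  by rewrite big_ord_recr /= (le_trans (IH Ly))// lerDl.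
rewrite big_ord_recr /= -[leLHS]addr0 lerD//.
apply: (@le_trans _ _ L%:R); first by rewrite lerBlDr natr1.
rewrite -[L in leLHS]card_ord -sumr_const ler_sum// => i _.
by rewrite (le_trans _ (ltW Ly)) ?ler_nat.
Qed.

(* A bounded measurable function with values in [0, M] is within 1/n of the
   average of the indicators of its level sets [f >= (i+1)/n]. *)
Lemma bdd_meas_ext (Phi : (T -> R) -> R) (K : R) :
  (forall f g, bdd_meas f -> bdd_meas g ->
    Phi (fun x => f x + g x) = Phi f + Phi g) ->
  (forall a f, bdd_meas f -> Phi (fun x => a * f x) = a * Phi f) ->
  (forall f c, bdd_meas f -> (forall x, `|f x| <= c) -> `|Phi f| <= K * c) ->
  (forall B, measurable B -> Phi \1_B = 0) ->
  forall f, bdd_meas f -> Phi f = 0.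
Proof.
move=> PhiD PhiZ Phib Phi1 f0 bf0.
wlog f_ge0 : f0 bf0 / forall x, 0 <= f0 x.
  move=> h; have [_ [M hM]] := bf0.
  have b1 := bdd_meas_cst 1.
  have := h (fun x => f0 x + M * 1) (bdd_measD bf0 (bdd_measZ M b1)).
  rewrite PhiD//; last exact: bdd_measZ.
  rewrite PhiZ// -[fun=> 1](_ : \1_setT = _); last first.
    by apply/funext => x; rewrite indicT.
  rewrite Phi1// mulr0 addr0; apply => x.
  by have := hM x; rewrite ler_norml => /andP[? _]; lra.
move: f0 bf0 f_ge0 => f bf f_ge0.
have PhiS I (s : seq I) (F : I -> T -> R) : (forall i, bdd_meas (F i)) ->
    (forall i, Phi (F i) = 0) -> Phi (fun x => \sum_(i <- s) F i x) = 0.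
  move=> h h0; elim: s => [|i s IH].
    have := PhiZ 0 _ (bdd_meas_cst 1); rewrite [X in _ = X]mul0r => h1;
      rewrite -[RHS]h1; congr Phi.
    by apply/funext => x; rewrite big_nil mul0r.
  under eq_fun do rewrite big_cons; rewrite PhiD// ?IH ?h0 ?addr0//.
  exact: bdd_meas_sum.
apply/eqP; rewrite -normr_eq0 eq_le normr_ge0 andbT; apply/ler_addgt0Pl => e e0.
rewrite addr0.
have K0 : 0 <= K.
  have := Phib (fun=> 1) 1 (bdd_meas_cst 1) (fun _ => _).
  by rewrite mulr1 => h; apply: le_trans (normr_ge0 _) (h _) => x; rewrite normr1.
have [n n0 Kn] : exists2 n : nat, (0 < n)%N & K / n%:R <= e.
  exists (Num.truncn (K / e)).+1 => //.
  rewrite ler_pdivrMr// mulrC -ler_pdivrMr// ltW//.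
  exact: truncnS_gt.
have nR : 0 < n%:R :> R by rewrite ltr0n.
have [mf [M hM]] := bf.
pose L := (Num.truncn (M * n%:R)).+1.
pose B (i : nat) := [set x | i.+1%:R <= f x * n%:R].
have mB i : measurable (B i).
  have -> : B i = f @^-1` `[i.+1%:R / n%:R, +oo[.
    by apply/seteqP; split => x; rewrite /B /= in_itv /= andbT ler_pdivrMr.
  by rewrite -[X in measurable X]setTI; exact: mf.
pose F (i : 'I_L) x := n%:R^-1 * (\1_(B i) x : R).
have bF i : bdd_meas (F i) by apply: bdd_measZ; exact: bdd_meas_indic.
have F0 i : Phi (F i) = 0.
  by rewrite PhiZ; [rewrite Phi1 ?mulr0|exact: bdd_meas_indic].
pose g x := f x + (-1) * \sum_(i < L) F i x.
have bg : bdd_meas g by apply: bdd_measD => //; apply: bdd_measZ;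
  exact: bdd_meas_sum.
have -> : Phi f = Phi g.
  rewrite PhiD// ?PhiZ ?PhiS ?mulr0 ?addr0//; first exact: bdd_meas_sum.
  by apply: bdd_measZ; exact: bdd_meas_sum.
apply: le_trans (Phib g n%:R^-1 bg _) Kn => x.
pose y := f x * n%:R.
have y0 : 0 <= y by rewrite mulr_ge0.
have yL : y <= L%:R.
  apply: le_trans (ltW (truncnS_gt _)); rewrite ler_wpM2r//.
  exact: le_trans (ler_norm _) (hM x).
have -> : g x = n%:R^-1 * (y - \sum_(i < L) (i.+1%:R <= y)%R%:R).
  rewrite /g /F -mulr_sumr /y mulrBr (mulrCA _ (f x)) mulVf ?gt_eqF// mulr1 mulN1r.
  congr (_ - _ * _); apply: eq_bigr => i _; rewrite indicE; congr (_%:R : R).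
  by congr nat_of_bool; apply/idP/idP; rewrite inE.
rewrite normrM gtr0_norm ?invr_gt0// -[leRHS]mulr1 ler_wpM2l ?invr_ge0//.
rewrite ger0_norm ?subr_ge0 ?count_le//.
by have := count_ge y0 yL; lra.
Qed.

End bounded_measurable.

Section expectation.
Context {R : realType} d {T : measurableType d} (P : probability T R).
Implicit Types (f g : T -> R).

Definition Ex f : R := \int[P]_w f w.

Lemma bdd_meas_integrable f : bdd_meas f -> P.-integrable setT (EFin \o f).
Proof.
move=> [mf [M hM]]; apply: measurable_bounded_integrable => //.
  exact: le_lt_trans (probability_le1 P measurableT) (ltry 1).
exists M; split; first exact: num_real.
by move=> y My x _; apply: le_trans (hM x) (ltW My).
Qed.

Lemma ExD f g : bdd_meas f -> bdd_meas g ->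
  Ex (fun x => f x + g x) = Ex f + Ex g.
Proof. by move=> bf bg; rewrite /Ex RintegralD//; exact: bdd_meas_integrable. Qed.

Lemma ExZ a f : bdd_meas f -> Ex (fun x => a * f x) = a * Ex f.
Proof. by move=> bf; rewrite /Ex RintegralZl//; exact: bdd_meas_integrable. Qed.

Lemma Ex_cst a : Ex (fun=> a) = a.
Proof.
rewrite /Ex Rintegral_cst// [X in fine X](_ : _ = 1%E) ?mulr1//.
exact: probability_setT.
Qed.

Lemma Ex_le f g : bdd_meas f -> bdd_meas g -> (forall x, f x <= g x) ->
  Ex f <= Ex g.
Proof.
by move=> bf bg fg; rewrite /Ex le_Rintegral//; exact: bdd_meas_integrable.
Qed.

Lemma Ex_indic B : measurable B -> (Ex \1_B)%:E = P B.
Proof.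
move=> mB; rewrite /Ex /Rintegral integral_indic// setIT fineK//.
exact: fin_num_measure.
Qed.

Lemma Ex_norm_le f c : bdd_meas f -> (forall x, `|f x| <= c) -> `|Ex f| <= c.
Proof.
move=> bf h; rewrite ler_norml -(Ex_cst (- c)) -{2}(Ex_cst c).
have bc a := bdd_meas_cst a; apply/andP; split; apply: Ex_le => // x;
  by have := h x; rewrite ler_norml => /andP[].
Qed.

Lemma Ex_sum I (s : seq I) (F : I -> T -> R) : (forall i, bdd_meas (F i)) ->
  Ex (fun x => \sum_(i <- s) F i x) = \sum_(i <- s) Ex (F i).
Proof.
move=> h; elim: s => [|i s IH].
  by rewrite big_nil; under eq_fun do rewrite big_nil; exact: Ex_cst.
rewrite big_cons -IH; under eq_fun do rewrite big_cons.
by rewrite ExD//; exact: bdd_meas_sum.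
Qed.

Lemma Ex_markov f (t : R) : 0 < t -> bdd_meas f -> (forall x, 0 <= f x) ->
  (P [set x | (t <= f x)%R] <= (Ex f / t)%:E)%E.
Proof.
move=> t0 bf f0; have [mf _] := bf.
have mB : measurable [set x | t <= f x].
  have -> : [set x | t <= f x] = f @^-1` `[t, +oo[.
    by apply/seteqP; split => x; rewrite /= in_itv /= andbT.
  by rewrite -[X in measurable X]setTI; exact: mf.
rewrite -Ex_indic// lee_fin ler_pdivlMr// mulrC -ExZ; last exact: bdd_meas_indic.
apply: Ex_le => //; first by apply: bdd_measZ; exact: bdd_meas_indic.
move=> x; rewrite indicE; case: (boolP (_ \in _)) => [|_]; last by rewrite mulr0.
by rewrite inE /= mulr1.
Qed.

End expectation.

(** * Independent samples *)

Section independence.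
Context {R : realType} {m N : nat} {d : measure_display} {T : measurableType d}.
Context {P : probability T R} (x : 'I_N -> {RV P >-> 'cV[R]_m}).
Hypothesis hind : independent_samples x.
Local Notation V := 'cV[R]_m.

Lemma bdd_meas_RV j (h : V -> R) : bdd_meas h -> bdd_meas (fun w => h (x j w)).
Proof. by move=> bh; exact: (bdd_meas_comp (measurable_funPT (x j)) bh). Qed.

(* The factors are passed from indicators to bounded measurable functions one
   index at a time. *)
Lemma Ex_prod_indep (h : 'I_N -> V -> R) : (forall j, bdd_meas (h j)) ->
  Ex P (fun w => \prod_j h j (x j w)) = \prod_j Ex P (fun w => h j (x j w)).
Proof.
suff H k : (k <= N)%N -> forall h, (forall j, bdd_meas (h j)) ->
    (forall j : 'I_N, (k <= j)%N -> exists2 B, measurable B & h j = \1_B) ->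
    Ex P (fun w => \prod_j h j (x j w)) = \prod_j Ex P (fun w => h j (x j w)).
  by move=> bh; apply: (H N) => // j; rewrite leqNgt ltn_ord.
elim: k => [_|k IH kN] {}h bh hB.
  have /choice[B hB'] (j : 'I_N) : exists B, measurable B /\ h j = \1_B.
    by have [B mB e] := hB j (leq0n _); exists B.
  have mB j : measurable (x j @^-1` B j).
    by rewrite -[X in measurable X]setTI; apply: measurable_funPT => //;
      case: (hB' j).
  have mC : measurable (\bigcap_(j in [set: 'I_N]) (x j @^-1` B j)).
    by apply: fin_bigcap_measurable.
  apply/EFin_inj; transitivity (P (\bigcap_(j in [set: 'I_N]) (x j @^-1` B j))).
    rewrite -Ex_indic//; congr (Ex P _)%:E; apply/funext => w.
    under eq_bigr do rewrite (hB' _).2 indicE.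
    rewrite indicE; case: (boolP (w \in _)) => [|/negP h0].
      by rewrite inE => hw; rewrite big1// => j _; rewrite mem_set//; exact: hw.
    have /existsNP[j hj] : ~ forall j, B j (x j w).
      by move=> hw; apply: h0; rewrite inE => j _; exact: hw.
    by rewrite (bigD1 j)//= memNset// mul0r.
  rewrite hind; last by move=> j; case: (hB' j).
  rewrite -prodEFin; apply: eq_bigr => j _.
  by rewrite -Ex_indic//; congr (Ex P _)%:E; apply/funext => w; rewrite (hB' j).2.
pose i := Ordinal kN.
pose rest w := \prod_(j | j != i) h j (x j w).
pose c := \prod_(j | j != i) Ex P (fun w => h j (x j w)).
have brest : bdd_meas rest.
  pose F (j : 'I_N) w := if j != i then h j (x j w) else 1.
  have -> : rest = fun w => \prod_j F j w.
    by apply/funext => w; rewrite /rest big_mkcond.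
  apply: bdd_meas_prod => j; rewrite /F; case: (j != i); last exact: bdd_meas_cst.
  exact: bdd_meas_RV.
(* The defect of factorization as a function of the factor of index [i]. It is linear and bounded,
   and vanishes on indicators by induction, so [bdd_meas_ext] applies. *)
pose Phi (g : V -> R) := Ex P (fun w => g (x i w) * rest w) +
  (- c) * Ex P (fun w => g (x i w)).
have [M hM] := brest.2.
suff : Phi (h i) = 0.
  rewrite /Phi mulNr mulrC => /eqP; rewrite subr_eq0 => /eqP.
  rewrite -[RHS](bigD1 i (F := fun j => Ex P (fun w => h j (x j w)))
    (P := predT))// => <-.
  by congr (Ex P _); apply/funext => w; rewrite (bigD1 i).
have brg g : bdd_meas g -> bdd_meas (fun w => g (x i w) * rest w).
  by move=> bg; apply: bdd_measM => //; exact: bdd_meas_RV.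
apply: (@bdd_meas_ext _ _ _ Phi (M + `|c|)) => //.
- move=> f g bf bg; rewrite /Phi ExD; [|exact: bdd_meas_RV..].
  under eq_fun do rewrite mulrDl.
  by rewrite ExD; [ring|exact: brg..].
- move=> a f bf; rewrite /Phi ExZ; last exact: bdd_meas_RV.
  under eq_fun do rewrite -mulrA.
  by rewrite ExZ; [ring|exact: brg].
- move=> f a bf hf; have bfx := bdd_meas_RV i bf.
  rewrite mulrDl /Phi; apply: le_trans (ler_normD _ _) _; apply: lerD.
    apply: Ex_norm_le; first exact: brg.
    by move=> w; rewrite normrM mulrC ler_pM.
  by rewrite normrM normrN ler_wpM2l//; apply: Ex_norm_le.
- move=> B mB; rewrite /Phi.
  pose h' j := if j == i then \1_B else h j.
  have h'i : h' i = \1_B by rewrite /h' eqxx.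
  have := IH (ltnW kN) h'; rewrite [in RHS](bigD1 i)//= h'i => IH'.
  rewrite mulNr mulrC; apply/eqP; rewrite subr_eq0; apply/eqP.
  transitivity (Ex P (fun w => \prod_j h' j (x j w))).
    congr (Ex P _); apply/funext => w; rewrite (bigD1 i)//= h'i; congr (_ * _).
    by apply: eq_bigr => j /negPf ji; rewrite /h' ji.
  rewrite IH'.
  + by congr (_ * _); apply: eq_bigr => j /negPf ji; rewrite /h' ji.
  + by move=> j; rewrite /h'; case: eqP => // _; exact: bdd_meas_indic.
  + move=> j kj; rewrite /h'; case: eqVneq => [_|ji]; first by exists B.
    by apply: hB; rewrite ltn_neqAle kj andbT eq_sym.
Qed.

(* Sums of products of functions of single samples among the first [k]: this
   algebra contains every polynomial in functions of these samples, and its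
   elements factor from functions of the sample of index [k]. *)
Inductive sample_alg (k : nat) : (T -> R) -> Prop :=
| sample_alg_prod a (h : 'I_N -> V -> R) : (forall j, bdd_meas (h j)) ->
    (forall j : 'I_N, (k <= j)%N -> h j = fun=> 1) ->
    sample_alg k (fun w => a * \prod_j h j (x j w))
| sample_alg_add f g : sample_alg k f -> sample_alg k g ->
    sample_alg k (fun w => f w + g w).

Lemma sample_alg_bdd k f : sample_alg k f -> bdd_meas f.
Proof.
elim=> [a h bh _|f1 f2 _ h1 _ h2]; last exact: bdd_measD.
by apply: bdd_measZ; apply: bdd_meas_prod => j; exact: bdd_meas_RV.
Qed.

Lemma sample_alg_cst k a : sample_alg k (fun=> a).
Proof.
have := @sample_alg_prod k a (fun _ _ => 1) (fun=> bdd_meas_cst 1)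
  (fun _ _ => erefl).
by under eq_fun do rewrite big1// mulr1.
Qed.

Lemma sample_algM k f g : sample_alg k f -> sample_alg k g ->
  sample_alg k (fun w => f w * g w).
Proof.
move=> hf; elim: hf g => {f} [a h bh h1 g|f1 f2 _ h1 _ h2 g hg]; last first.
  under eq_fun do rewrite mulrDl.
  by apply: sample_alg_add; [exact: h1|exact: h2].
elim=> {g} [b h' bh' h1'|g1 g2 _ hg1 _ hg2]; last first.
  by under eq_fun do rewrite mulrDr; exact: sample_alg_add.
under eq_fun do rewrite mulrACA -big_split/=.
apply: (@sample_alg_prod k (a * b) (fun j v => h j v * h' j v)) => [j|j kj].
  exact: bdd_measM.
by apply/funext => v; rewrite h1// h1'// mul1r.
Qed.

Lemma sample_alg_sum k I (s : seq I) (F : I -> T -> R) :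
  (forall i, sample_alg k (F i)) -> sample_alg k (fun w => \sum_(i <- s) F i w).
Proof.
move=> h; elim: s => [|i s IH].
  by under eq_fun do rewrite big_nil; exact: sample_alg_cst.
by under eq_fun do rewrite big_cons; exact: sample_alg_add.
Qed.

Lemma sample_alg_RV k (j : 'I_N) g : (j < k)%N -> bdd_meas g ->
  sample_alg k (fun w => g (x j w)).
Proof.
move=> jk bg; pose h (i : 'I_N) := if i == j then g else fun=> 1.
have -> : (fun w => g (x j w)) = fun w => 1 * \prod_i h i (x i w).
  apply/funext => w; rewrite (bigD1 j)//= big1/=; last first.
    by move=> i /negPf ij; rewrite /h ij.
  by rewrite /h eqxx mulr1 mul1r.
apply: sample_alg_prod => [i|i ki]; rewrite /h.
  by case: eqP => // _; exact: bdd_meas_cst.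
by case: eqP => // ij; move: ki; rewrite ij leqNgt jk.
Qed.

Lemma Ex_sample_alg_indep (k : 'I_N) f g : sample_alg k f -> bdd_meas g ->
  Ex P (fun w => f w * g (x k w)) = Ex P f * Ex P (fun w => g (x k w)).
Proof.
move=> hf bg; have bgx := bdd_meas_RV k bg.
elim: hf => {f} [a h bh h1|f1 f2 hf1 IH1 hf2 IH2]; last first.
  have b1 := sample_alg_bdd hf1; have b2 := sample_alg_bdd hf2.
  under eq_fun do rewrite mulrDl.
  by rewrite !ExD ?IH1 ?IH2 ?mulrDl//; exact: bdd_measM.
pose h' j := if j == k then g else h j.
have h'k : h' k = g by rewrite /h' eqxx.
have bh' j : bdd_meas (h' j) by rewrite /h'; case: eqP.
have E w : (a * \prod_j h j (x j w)) * g (x k w) = a * \prod_j h' j (x j w).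
  rewrite -mulrA; congr (_ * _); rewrite (bigD1 k)//= h1// mul1r mulrC.
  rewrite [RHS](bigD1 k)//= h'k; congr (_ * _).
  by apply: eq_bigr => j /negPf jk; rewrite /h' jk.
have bprod (l : 'I_N -> V -> R) : (forall j, bdd_meas (l j)) ->
    bdd_meas (fun w => \prod_j l j (x j w)).
  by move=> bl; apply: bdd_meas_prod => j; exact: bdd_meas_RV.
under eq_fun do rewrite E.
rewrite !ExZ; [|exact: bprod..].
rewrite !Ex_prod_indep// -mulrA; congr (_ * _).
rewrite (bigD1 k)//= [in RHS](bigD1 k)//= h1// Ex_cst mul1r mulrC h'k.
by congr (_ * _); apply: eq_bigr => j /negPf jk; rewrite /h' jk.
Qed.

End independence.

(** * Matrix Laplace transform *)

Section matrix_closure.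
Context {R : realType} {U : Type} {q : nat} (Q : (U -> R) -> Prop).
Hypothesis Qcst : forall a, Q (fun=> a).
Hypothesis QD : forall f g, Q f -> Q g -> Q (fun x => f x + g x).
Hypothesis QM : forall f g, Q f -> Q g -> Q (fun x => f x * g x).

(** [Q] is meant for both [bdd_meas] and [sample_alg x k]: the same closure argument gives
    boundedness of matrix polynomials and their dependence on the first samples alone. *)
Lemma closed_sum I (s : seq I) (F : I -> U -> R) :
  (forall i, Q (F i)) -> Q (fun x => \sum_(i <- s) F i x).
Proof.
move=> h; elim: s => [|i s IH]; first by under eq_fun do rewrite big_nil.
by under eq_fun do rewrite big_cons; exact: QD.
Qed.

Lemma closed_mulmx (A B : U -> 'M[R]_q) :
  (forall a b, Q (fun x => A x a b)) -> (forall a b, Q (fun x => B x a b)) ->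
  forall a b, Q (fun x => (A x *m B x) a b).
Proof.
move=> hA hB a b; under eq_fun do rewrite mxE.
by apply: closed_sum => i; exact: QM.
Qed.

Lemma closed_expr1D c k (A : U -> 'M[R]_q) :
  (forall a b, Q (fun x => A x a b)) ->
  forall a b, Q (fun x => ((1 + c *: A x) ^+ k) a b).
Proof.
move=> hA; elim: k => [a b|k IH a b].
  by under eq_fun do rewrite expr0; exact: Qcst.
under eq_fun do rewrite exprS.
apply: closed_mulmx => // i j; under eq_fun do rewrite !mxE.
by apply: QD => //; exact: QM.
Qed.

Lemma closed_mxtrace (A : U -> 'M[R]_q) :
  (forall a b, Q (fun x => A x a b)) -> Q (fun x => \tr (A x)).
Proof. by move=> hA; exact: closed_sum. Qed.

Lemma closed_dot (A : U -> 'M[R]_q) u v :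
  (forall a b, Q (fun x => A x a b)) -> Q (fun x => dot u (A x *m v)).
Proof.
move=> hA; under eq_fun do rewrite dotE.
apply: closed_sum => i; apply: QM => //; under eq_fun do rewrite mxE.
by apply: closed_sum => j; exact: QM.
Qed.

End matrix_closure.

Section matrix_expectation.
Context {R : realType} {d : measure_display} {T : measurableType d}.
Context (P : probability T R) {q : nat}.

Definition ExM (F : T -> 'M[R]_q) : 'M[R]_q :=
  \matrix_(a, b) Ex P (fun w => F w a b).

Lemma dot_ExM (F : T -> 'M[R]_q) u v : (forall a b, bdd_meas (fun w => F w a b)) ->
  dot u (ExM F *m v) = Ex P (fun w => dot u (F w *m v)).
Proof.
move=> bF; rewrite dotE; under [in RHS]eq_fun do rewrite dotE.
have bFv a : bdd_meas (fun w => (F w *m v) a 0).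
  under eq_fun do rewrite mxE; apply: bdd_meas_sum => b.
  by apply: bdd_measM => //; exact: bdd_meas_cst.
rewrite Ex_sum; last by move=> a; exact: bdd_measZ.
apply: eq_bigr => a _; rewrite ExZ//; congr (_ * _).
rewrite mxE; under [in RHS]eq_fun do rewrite mxE.
rewrite Ex_sum => [|b]; last by apply: bdd_measM => //; exact: bdd_meas_cst.
apply: eq_bigr => b _; rewrite mxE mulrC -ExZ//; congr (Ex P _).
by apply/funext => w; rewrite mulrC.
Qed.

End matrix_expectation.

Section matrix_laplace.
Context {R : realType} {m N q : nat} {d : measure_display} {T : measurableType d}.
Context {P : probability T R} (x : 'I_N -> {RV P >-> 'cV[R]_m}).
Context (H : 'cV[R]_m -> 'M[R]_q) (sigma : R).
Hypothesis hind : independent_samples x.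
Hypothesis bH : forall a b, bdd_meas (fun v => H v a b).
Hypothesis sH : forall v, (H v)^T = H v.
Hypothesis oH : forall v, opbound (H v) 1.
Hypothesis EH : forall j, ExM P (fun w => H (x j w)) = 0.
Hypothesis EHH : forall j u,
  Ex P (fun w => dot (H (x j w) *m u) (H (x j w) *m u)) <= sigma * dot u u.
Hypothesis sigma0 : 0 <= sigma.

Definition partial_sum (k : nat) w := \sum_(j < N | (j < k)%N) H (x j w).

Lemma partial_sum0 w : partial_sum 0 w = 0.
Proof. by rewrite /partial_sum big_pred0. Qed.

Lemma partial_sumS (k : 'I_N) w : partial_sum k.+1 w = partial_sum k w + H (x k w).
Proof.
rewrite /partial_sum (bigD1 k)//= addrC; congr (_ + _); apply: eq_bigl => j.
by rewrite ltnS [in RHS]ltn_neqAle andbC.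
Qed.

Lemma partial_sum_full w : partial_sum N w = \sum_j H (x j w).
Proof. by apply: eq_bigl => j; rewrite ltn_ord. Qed.

Lemma tr_partial_sum k w : (partial_sum k w)^T = partial_sum k w.
Proof. by rewrite /partial_sum linear_sum; apply: eq_bigr => j _; exact: sH. Qed.

Lemma opbound_partial_sum k w : opbound (partial_sum k w) N%:R.
Proof.
rewrite /partial_sum big_mkcond.
have szN : size (index_enum 'I_N) = N by rewrite -[RHS]card_ord cardT enumT.
rewrite -[N%:R]mulr1 -[X in X%:R * 1]szN; apply: opbound_sum => j.
case: ifP => _; first exact: oH.
by apply: opbound_le (@opbound0 _ _ _).
Qed.

Lemma sample_alg_partial_sum k a b : sample_alg x k (fun w => partial_sum k w a b).
Proof.
have -> : (fun w => partial_sum k w a b) =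
    fun w => \sum_(j < N) (if (j < k)%N then H (x j w) a b else 0).
  by apply/funext => w; rewrite /partial_sum summxE big_mkcond.
apply: sample_alg_sum => j; case: (ltnP j k) => jk; last exact: sample_alg_cst.
exact: (sample_alg_RV x jk (bH a b)).
Qed.

Variable p : nat.
(** Golden-Thompson needs a power of 2; the successor makes it even, so that [A k w] is a square and
    [mxtrace_mul_quad_le] applies. *)
Let K := (2 ^ p.+1)%N.
Let A k w := (1 + K%:R^-1 *: partial_sum k w) ^+ K.
Let B v := (1 + K%:R^-1 *: H v) ^+ K.

Let algA k a b : sample_alg x k (fun w => A k w a b).
Proof.
apply: (closed_expr1D (sample_alg_cst _ _) (@sample_alg_add _ _ _ _ _ _ _ _)
  (@sample_algM _ _ _ _ _ _ _ _)).
exact: sample_alg_partial_sum.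
Qed.

Let bB a b : bdd_meas (fun v => B v a b).
Proof.
by apply: (closed_expr1D (@bdd_meas_cst _ _ _) (@bdd_measD _ _ _)
  (@bdd_measM _ _ _)).
Qed.

Let bBx j a b : bdd_meas (fun w => B (x j w) a b).
Proof. exact: (bdd_meas_RV x j (bB a b)). Qed.

Let bA k a b : bdd_meas (fun w => A k w a b).
Proof. exact: sample_alg_bdd (algA k a b). Qed.

Lemma mxtrace_mul_indep (k : 'I_N) :
  Ex P (fun w => \tr (A k w *m B (x k w))) =
  Ex P (fun w => \tr (A k w *m ExM P (fun w => B (x k w)))).
Proof.
have bAB a b : bdd_meas (fun w => A k w a b * B (x k w) b a) by exact: bdd_measM.
have bAE a b : bdd_meas (fun w => A k w a b * ExM P (fun w => B (x k w)) b a).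
  by apply: bdd_measM => //; exact: bdd_meas_cst.
rewrite /mxtrace; under eq_fun do under eq_bigr do rewrite mxE.
under [in RHS]eq_fun do under eq_bigr do rewrite mxE.
rewrite !Ex_sum; do ?by move=> a; exact: bdd_meas_sum.
apply: eq_bigr => a _; rewrite !Ex_sum//; apply: eq_bigr => b _.
rewrite (Ex_sample_alg_indep hind (algA k a b) (bB b a)) mulrC.
under [in RHS]eq_fun do rewrite mulrC.
by rewrite ExZ// mxE.
Qed.

(** The expectation of [quad_expr_le]: the linear term vanishes because [H] is centred, and the
    quadratic one is the variance. *)
Lemma quad_ExM_le (k : 'I_N) u :
  dot u (ExM P (fun w => B (x k w)) *m u) <= (1 + expR 1 * sigma) * dot u u.
Proof.
have bHx a b : bdd_meas (fun w => H (x k w) a b) := bdd_meas_RV x k (bH a b).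
have bd := closed_dot (@bdd_meas_cst _ _ T) (@bdd_measD _ _ T) (@bdd_measM _ _ T).
have bHu : bdd_meas (fun w => dot u (H (x k w) *m u)) by exact: bd.
have bHHu : bdd_meas (fun w => dot (H (x k w) *m u) (H (x k w) *m u)).
  under eq_fun do rewrite dot_mulmxl sH mulmxA; apply: bd.
  exact: (closed_mulmx (@bdd_meas_cst _ _ T) (@bdd_measD _ _ T) (@bdd_measM _ _ T)).
rewrite dot_ExM//.
apply: (@le_trans _ _ (Ex P (fun w => dot u u + dot u (H (x k w) *m u) +
    expR 1 * dot (H (x k w) *m u) (H (x k w) *m u)))).
  apply: Ex_le; first exact: bd.
    apply: bdd_measD; last exact: bdd_measZ.
    by apply: bdd_measD => //; exact: bdd_meas_cst.
  by move=> w; apply: quad_expr_le; rewrite ?expn_gt0.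
rewrite ExD; [|apply: bdd_measD => //; exact: bdd_meas_cst|exact: bdd_measZ].
rewrite ExD//; last exact: bdd_meas_cst.
rewrite Ex_cst ExZ// -dot_ExM// EH mul0mx dotC dot0l addr0 mulrDl mul1r lerD2l.
by rewrite -mulrA ler_wpM2l ?expR_ge0.
Qed.

(* Golden-Thompson separates the last sample, independence averages it out. *)
Lemma matrix_laplace k : (k <= N)%N ->
  Ex P (fun w => \tr ((1 + K%:R^-1 *: partial_sum k w) ^+ K)) <=
  (1 + expR 1 * sigma) ^+ k *
    (q%:R + k%:R * (q%:R * (N%:R * expR (2 * N%:R + 1)) / K%:R)).
Proof.
set beta := 1 + _; set eps := _ / K%:R.
have beta1 : 1 <= beta by rewrite lerDl mulr_ge0 ?expR_ge0.
have eps0 : 0 <= eps by rewrite !mulr_ge0 ?expR_ge0 ?invr_ge0.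
have btr k' : bdd_meas (fun w => \tr (A k' w)).
  exact: (closed_mxtrace (@bdd_meas_cst _ _ T) (@bdd_measD _ _ T)).
elim: k => [_|k IH kN].
  under eq_fun do rewrite partial_sum0 scaler0 addr0 expr1n mxtrace1.
  by rewrite Ex_cst expr0 mul1r mul0r addr0.
pose i := Ordinal kN; pose EB := ExM P (fun w => B (x i w)).
have bmul (F : T -> 'M[R]_q) : (forall a b, bdd_meas (fun w => F w a b)) ->
    bdd_meas (fun w => \tr (A k w *m F w)).
  move=> bF; apply: (closed_mxtrace (@bdd_meas_cst _ _ T) (@bdd_measD _ _ T)).
  exact: (closed_mulmx (@bdd_meas_cst _ _ T) (@bdd_measD _ _ T) (@bdd_measM _ _ T)).
apply: (@le_trans _ _ (Ex P (fun w => \tr (A k w *m B (x i w)) + eps))).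
  apply: Ex_le; first exact: (btr k.+1).
    by apply: bdd_measD; [exact: bmul|exact: bdd_meas_cst].
  move=> w; rewrite (partial_sumS i); apply: mxtrace_expr_step => //.
  - exact: tr_partial_sum.
  - exact: opbound_partial_sum.
rewrite ExD; [|exact: bmul|exact: bdd_meas_cst].
rewrite Ex_cst (mxtrace_mul_indep i) -/EB.
have : Ex P (fun w => \tr (A k w *m EB)) <= beta * Ex P (fun w => \tr (A k w)).
  rewrite -ExZ//; apply: Ex_le.
  - by apply: bmul => a b; exact: bdd_meas_cst.
  - exact: bdd_measZ.
  - move=> w; rewrite /A /K expnS mulnC exprM expr2.
    apply: mxtrace_mul_quad_le => [|u]; last exact: (quad_ExM_le i u).
    by rewrite trmxX linearD/= linearZ/= trmx1 tr_partial_sum.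
have := IH (ltnW kN); rewrite -/(A k _).
(* As [beta ^+ k.+1 >= 1], the new additive error [eps] can be moved inside the factor multiplied by
   that power. *)
rewrite exprS -natr1; have : 1 <= beta * beta ^+ k by rewrite -exprS exprn_ege1.
have beta0 : 0 <= beta by apply: le_trans beta1.
set b := beta ^+ k; set e1 := Ex P _; set e2 := Ex P _; move=> h1 h2 h3.
have : beta * e1 <= beta * (b * (q%:R + k%:R * eps)) by rewrite ler_wpM2l.
nra.
Qed.

End matrix_laplace.

(** * Matrix Bernstein inequality *)

Section matrix_tail.
Context {R : realType}.

Lemma exists_exp2_ge (M : R) : exists p, M <= (2 ^ p.+1)%N%:R.
Proof.
exists (Num.truncn M); apply: le_trans (ltW (truncnS_gt M)) _.
by rewrite ler_nat ltnW// ltn_expl.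
Qed.

(** With y = t/K, log(1 + y) >= y/(1 + y) gives the exponent t/(1 + y), which is at least t - 1
    because t y <= 1. *)
Lemma expR_sub1_le (t : R) K : (0 < K)%N -> 0 <= t -> t * t <= K%:R ->
  expR (t - 1) <= (1 + K%:R^-1 * t) ^+ K.
Proof.
move=> K0 t0 tK; set y := K%:R^-1 * t.
have KR : 0 < K%:R :> R by rewrite ltr0n.
have y0 : 0 <= y by rewrite mulr_ge0 ?invr_ge0.
have y1 : 0 < 1 + y by rewrite ltr_wpDr.
have h : expR (y / (1 + y)) <= 1 + y.
  have := expR_ge1Dx (- (y / (1 + y))); rewrite expRN.
  have -> : 1 - y / (1 + y) = (1 + y)^-1 by field; rewrite gt_eqF.
  by rewrite lef_pV2// posrE expR_gt0.
apply: (@le_trans _ _ (expR (y / (1 + y)) ^+ K)); last first.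
  by rewrite lerXn2r// nnegrE ?expR_ge0 ?ltW.
rewrite -expRM_natl ler_expR mulrA ler_pdivlMr//.
have -> : K%:R * y = t by rewrite /y mulrA mulfV ?mul1r ?gt_eqF.
have : t * y <= 1 by rewrite /y mulrCA -ler_pdivlMl ?invr_gt0// invrK mulr1.
nra.
Qed.

Context {m N q : nat} {d : measure_display} {T : measurableType d}.
Context {P : probability T R} (x : 'I_N -> {RV P >-> 'cV[R]_m}).

(** Markov's inequality for the trace of the [K]-th power, at the threshold [tau] that stands for
    e^t. If the conclusion failed in some direction, [expr_quad_le_mxtrace] would force the trace up
    to [tau]. The Laplace parameter is 1, scaling being left to the choice of [H]. *)
Lemma matrix_bernstein (H : 'cV[R]_m -> 'M[R]_q) (sigma t : R) :
  independent_samples x ->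
  (forall a b, bdd_meas (fun v => H v a b)) ->
  (forall v, (H v)^T = H v) -> (forall v, opbound (H v) 1) ->
  (forall j, ExM P (fun w => H (x j w)) = 0) ->
  (forall j u, Ex P (fun w => dot (H (x j w) *m u) (H (x j w) *m u)) <=
    sigma * dot u u) ->
  0 <= sigma -> 0 <= t ->
  exists2 A : set T, measurable A &
    (P (~` A) <= (2 * q%:R * expR (N%:R * (expR 1 * sigma) - t + 1))%:E)%E /\
    forall w, A w -> forall u,
      dot u ((\sum_j H (x j w)) *m u) <= t * dot u u.
Proof.
move=> hind bH sH oH EH EHH sigma0 t0.
pose M1 := N%:R * (N%:R * expR (2 * N%:R + 1)) : R.
have M10 : 0 <= M1 by rewrite !mulr_ge0 ?expR_ge0.
(* The summand [t * t] serves [expR_sub1_le]; [M1] brings the error accumulated over the [N] steps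
   below [q], whence the factor 2 in front of [q]. *)
have [p hp] := exists_exp2_ge (t * t + M1).
set K := (2 ^ p.+1)%N in hp.
have K0 : (0 < K)%N by rewrite expn_gt0.
have KR : 0 < K%:R :> R by rewrite ltr0n.
have tt0 : 0 <= t * t by rewrite mulr_ge0.
pose tau : R := (1 + K%:R^-1 * t) ^+ K.
have tau_ge : expR (t - 1) <= tau by apply: expR_sub1_le => //; lra.
have tau0 : 0 < tau by apply: lt_le_trans tau_ge; exact: expR_gt0.
pose f w := \tr ((1 + K%:R^-1 *: partial_sum x H N w) ^+ K).
have bf : bdd_meas f.
  apply: (closed_mxtrace (@bdd_meas_cst _ _ T) (@bdd_measD _ _ T)).
  apply: (closed_expr1D (@bdd_meas_cst _ _ T) (@bdd_measD _ _ T)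
    (@bdd_measM _ _ T)).
  by move=> a b; exact: sample_alg_bdd (sample_alg_partial_sum x bH N a b).
have f0 w : 0 <= f w.
  rewrite /f /K expnS mulnC exprM expr2.
  set B := _ ^+ _; have -> : B = B^T.
    by rewrite /B trmxX linearD/= linearZ/= trmx1 tr_partial_sum.
  rewrite {1}[B^T](_ : _ = B) ?mxtrace_trmxM; last first.
    by rewrite /B trmxX linearD/= linearZ/= trmx1 tr_partial_sum.
  by apply: sumr_ge0 => i _; apply: sumr_ge0 => j _; exact: sqr_ge0.
have [mf _] := bf.
have mA : measurable [set w | tau <= f w].
  have -> : [set w | tau <= f w] = f @^-1` `[tau, +oo[.
    by apply/seteqP; split => w; rewrite /= in_itv /= andbT.
  by rewrite -[X in measurable X]setTI; exact: mf.
exists (~` [set w | tau <= f w]); first exact: measurableC.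
rewrite setCK; split.
    apply: le_trans (Ex_markov P tau0 bf f0) _; rewrite lee_fin ler_pdivrMr//.
  apply: le_trans (matrix_laplace hind bH sH oH EH EHH sigma0 p (leqnn N)) _.
  rewrite -/K.
  have h1 : (1 + expR 1 * sigma) ^+ N <= expR (N%:R * (expR 1 * sigma)).
    rewrite expRM_natl lerXn2r// ?nnegrE ?expR_ge0 ?expR_ge1Dx//.
    by rewrite addr_ge0// mulr_ge0 ?expR_ge0.
  have h2 : q%:R + N%:R * (q%:R * (N%:R * expR (2 * N%:R + 1)) / K%:R) <= 2 *
    q%:R :> R.
    rewrite [X in _ + X](_ : _ = q%:R * (M1 / K%:R)); last by rewrite /M1; ring.
    have : M1 / K%:R <= 1 by rewrite ler_pdivrMr// mul1r; lra.
    have := ler0n R q; nra.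
  have b0 : 0 <= (1 + expR 1 * sigma) ^+ N.
    by rewrite exprn_ge0// addr_ge0// mulr_ge0 ?expR_ge0.
  apply: (@le_trans _ _ (expR (N%:R * (expR 1 * sigma)) * (2 * q%:R))).
    by apply: ler_pM => //; rewrite addr_ge0// !mulr_ge0 ?expR_ge0 ?invr_ge0.
  rewrite [leLHS]mulrC -[leRHS]mulrA ler_wpM2l ?mulr_ge0//.
  apply: (@le_trans _ _ (expR (N%:R * (expR 1 * sigma) - t + 1) *
    expR (t - 1))); last first.
    by rewrite ler_wpM2l ?expR_ge0.
  by rewrite -expRD ler_expR; lra.
move=> w /= /negP; rewrite -ltNge => fw u; rewrite leNgt; apply/negP => hu.
have u0 : u != 0.
  by apply/eqP => u0; move: hu; rewrite u0 !dot0l mulr0 ltxx.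
have uu : 0 < dot u u by rewrite lt_neqAle eq_sym dot_eq0 u0 dot_ge0.
have nu : 0 < enorm u by rewrite lt_neqAle eq_sym enorm_eq0 u0 enorm_ge0.
pose v := (enorm u)^-1 *: u.
have vv : dot v v = 1.
  by rewrite /v dotZl dotZr -sqr_enorm mulrA expr2; field; rewrite gt_eqF.
set S := partial_sum x H N w in fw *.
have hv : t <= dot v (S *m v).
  rewrite /v -scalemxAr dotZl dotZr mulrA -invfM -expr2 sqr_enorm ler_pdivlMl//.
  by rewrite mulrC /S partial_sum_full ltW.
set M := 1 + K%:R^-1 *: S in fw.
have hM : 1 + K%:R^-1 * t <= dot v (M *m v).
  by rewrite /M mulmxDl mul1mx dotDr vv -scalemxAl dotZr lerD2l ler_wpM2l ?invr_ge0.
have q0 : 0 <= 1 + K%:R^-1 * t by rewrite addr_ge0 ?mulr_ge0 ?invr_ge0.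
have sM : M^T = M by rewrite /M linearD/= linearZ/= trmx1 tr_partial_sum.
have := expr_quad_le_mxtrace p sM vv (le_trans q0 hM).
rewrite leNgt => /negP; apply; apply: lt_le_trans fw _.
by rewrite lerXn2r// nnegrE// (le_trans q0).
Qed.

End matrix_tail.

(** * Differentials relative to a set *)

Section within_differential.
Context {R : realType} {m : nat}.
Implicit Types (X : set 'cV[R]_m) (f : 'cV[R]_m -> R) (x y : 'cV[R]_m).

Lemma nbhs_colvecP x (Q : set 'cV[R]_m) : nbhs x Q ->
  exists2 e : R, 0 < e & forall y, (forall j, `|x j 0 - y j 0| < e) -> Q y.
Proof.
move=> /nbhs_ballP[e e0 he]; exists e => // y hy; apply: he.
by split=> // i j; rewrite ord1; exact: hy.
Qed.

Lemma within_differentialP X f x e : X x -> 0 < e ->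
  differentiable f (within X (nbhs x)) ->
  exists2 r : R, 0 < r & forall y, X y -> (forall j, `|x j 0 - y j 0| < r) ->
    `|f y - f x - 'd f (within X (nbhs x)) (y - x)| <= e * `|y - x|.
Proof.
move=> Xx e0 df; have := diffE df.
(* [diffE] expands at the limit of the filter; [X x] makes the relative filter proper, so that its
   limit is unique. *)
have -> : lim (within X (nbhs x)) = x.
  have pF : ProperFilter (within X (nbhs x)).
    by apply: within_nbhs_proper; exact: subset_closure.
  have cF : within X (nbhs x) --> x by exact: cvg_within.
  exact: (@cvg_unique _ (@norm_hausdorff _ _) _ pF _ _ (cvgP _ cF) cF).
move=> /funext/eqaddoP/(_ e e0) h.
have [r r0 hr] := nbhs_colvecP h.
exists r => // y Xy hy; have := hr y hy Xy.
by rewrite /= opprD addrA.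
Qed.

Lemma within_differential_continuous X f x e : X x -> 0 < e ->
  differentiable f (within X (nbhs x)) ->
  exists2 r : R, 0 < r & forall y, X y -> (forall j, `|x j 0 - y j 0| < r) ->
    `|f y - f x| < e.
Proof.
move=> Xx e0 df; have [r r0 hr] := within_differentialP Xx ltr01 df.
set D := 'd f (within X (nbhs x)) in hr.
have e20 : 0 < e / 2 by rewrite divr_gt0.
have : nbhs (0 : 'cV[R]_m) [set z | `|D z| < e / 2].
  have cD : D @ (0 : 'cV[R]_m) --> D 0 by exact: (diff_continuous df).
  move/cvgrPdist_lt : cD => /(_ _ e20); rewrite linear0.
  by apply: filterS => z; rewrite /= sub0r normrN.
move=> /nbhs_colvecP[r1 r10 hr1].
have : nbhs (0 : 'cV[R]_m) [set z | `|z| < e / 2].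
  exact: (@nbhs0_lt _ 'cV[R]_m).
move=> /nbhs_colvecP[r2 r20 hr2].
exists (Num.min r (Num.min r1 r2)); first by rewrite !lt_min r0 r10.
move=> y Xy hy.
have near0 s : (forall j, `|x j 0 - y j 0| < s) ->
    forall j, `|(0 : 'cV[R]_m) j 0 - (y - x) j 0| < s.
  by move=> h j; rewrite !mxE sub0r opprB.
have {}hr : `|f y - f x - D (y - x)| <= 1 * `|y - x|.
  by apply: hr => // j; have := hy j; rewrite !lt_min => /andP[].
have {}hr1 : `|D (y - x)| < e / 2.
  by apply: hr1; apply: near0 => j; have := hy j; rewrite !lt_min => /and3P[].
have {}hr2 : `|y - x| < e / 2.
  by apply: hr2; apply: near0 => j; have := hy j; rewrite !lt_min => /and3P[].
rewrite -[f y - f x](subrK (D (y - x))); apply: le_lt_trans (ler_normD _ _) _.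
by move: hr; rewrite mul1r; lra.
Qed.

Lemma normr_delta_mx_le1 (i : 'I_m) : `|delta_mx i 0 : 'cV[R]_m| <= 1.
Proof.
rewrite /Num.norm /= mx_normrE; apply/bigmax_leP; split=> // j _.
by rewrite mxE; case: (_ && _); rewrite ?normr1 ?normr0.
Qed.

Definition set_coord (i : 'I_m) x (t : R) : 'cV[R]_m :=
  \col_j (if j == i then t else x j 0).

Lemma set_coordB i x t : set_coord i x t - x = (t - x i 0) *: delta_mx i 0.
Proof.
apply/matrixP => j k; rewrite ord1 !mxE andbT.
by case: eqVneq => [->|_]; rewrite ?mulr1// subrr mulr0.
Qed.

(** The difference quotient multiplied by the squared increment: no division occurs, so [t = x i 0]
    is allowed and the conditions stay visibly measurable. *)
Lemma gradient_quotient X f x e i : X x -> 0 < e ->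
  differentiable f (within X (nbhs x)) ->
  exists2 r : R, 0 < r & forall t, X (set_coord i x t) -> `|t - x i 0| < r ->
    `|(f (set_coord i x t) - f x) * (t - x i 0)
      - gradient X f x i 0 * (t - x i 0) ^+ 2| <= e * (t - x i 0) ^+ 2.
Proof.
move=> Xx e0 df; have [r r0 hr] := within_differentialP Xx e0 df.
exists r => // t Xt tr.
have := hr _ Xt; rewrite set_coordB linearZ /= => /(_ _)/wrap[].
  move=> j; rewrite mxE; case: eqVneq => [->|_]; first by rewrite distrC.
  by rewrite subrr normr0.
rewrite /gradient mxE; set h := t - x i 0; set D := 'd f (within X (nbhs x)) _;
  set q := f _ - f x.
rewrite normrZ => hq.
have -> : q * h - D * h ^+ 2 = (q - h *: D) * h by rewrite /GRing.scale/=; ring.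
rewrite normrM -[h ^+ 2]ger0_norm ?sqr_ge0// normrX expr2 mulrA.
rewrite ler_wpM2r//; apply: le_trans hq _.
rewrite ler_wpM2l ?(ltW e0)// -[leRHS]mulr1 ler_wpM2l//.
exact: normr_delta_mx_le1.
Qed.

End within_differential.

Section density_support.
Context {R : realType} {m : nat}.
Implicit Types (X : set 'cV[R]_m) (rho f : 'cV[R]_m -> R) (x y : 'cV[R]_m).

Lemma density_on_neq0 X rho x : density_on X rho -> rho x != 0 <-> X x.
Proof.
move=> [_ pos out _ _]; split=> [r0|Xx]; last by rewrite gt_eqF ?pos.
by apply: contra_notP (elimN eqP r0) => /out.
Qed.

Lemma measurable_density_support X rho : density_on X rho -> measurable X.
Proof.
move=> hrho; have [mrho _ _ _ _] := hrho.
have -> : X = ~` (rho @^-1` [set 0]).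
  apply/seteqP; split=> x /=; rewrite -(density_on_neq0 x hrho) => h;
    first exact/eqP.
  exact/eqP.
apply: measurableC; rewrite -[X in measurable X]setTI.
exact: mrho.
Qed.

Lemma density_support_neq0 X rho : density_on X rho -> exists x, X x.
Proof.
move=> [_ _ out _ int1]; apply: contrapT => /forallNP h.
have : (\int[lebesgue_colvec m]_x (rho x)%:E = 0)%E.
  by rewrite -[RHS](@integral0 _ _ _ (lebesgue_colvec m) setT);
    apply: eq_integral => x _; rewrite out.
by rewrite int1 => /eqP; rewrite onee_eq0.
Qed.

(** Separability makes the support a product set, so a coordinate can move within its projection
    without leaving [X]. *)
Lemma density_support_set_coord X rho x y i : density_on X rho -> separable rho ->
  X x -> X y -> X (set_coord i x (y i 0)).
Proof.
move=> hrho [r hr]; rewrite -!(density_on_neq0 _ hrho) !hr.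
move=> /prodf_neq0 hx /prodf_neq0 hy; apply/prodf_neq0 => j _.
by rewrite mxE; case: (eqVneq j i) => [->|_]; [exact: hy|exact: hx].
Qed.

Lemma measurable_set_coord i t :
  measurable_fun setT (set_coord i ^~ t : 'cV[R]_m -> 'cV[R]_m).
Proof.
apply/measurable_fun_colvecP => j.
rewrite (_ : _ \o _ = fun x => if j == i then t else x j 0); last first.
  by apply/funext => x; rewrite /colvec_coord/= mxE.
case: (j == i); first exact: measurable_cst.
exact: measurable_colvec_coord.
Qed.

Lemma measurable_ge0_set d (T : measurableType d) (u : T -> R) :
  measurable_fun setT u -> measurable [set x | 0 <= u x].
Proof.
move=> mu; rewrite (_ : [set x | _] = u @^-1` `[0, +oo[).
  by rewrite -[X in measurable X]setTI; exact: mu.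
by apply/seteqP; split => x; rewrite /= in_itv /= andbT.
Qed.

(* Relatively open subsets of [X] are unions of traces of rational boxes. *)
Lemma measurable_relatively_open X (U : set 'cV[R]_m) : measurable X -> U `<=` X ->
  (forall x, U x -> exists2 r : R, 0 < r &
    forall y, X y -> (forall j, `|x j 0 - y j 0| < r) -> U y) ->
  measurable U.
Proof.
move=> mX UX hU.
pose box (z : {ffun 'I_m -> rat} * nat) : set 'cV[R]_m :=
  \bigcap_(j in [set: 'I_m])
    (colvec_coord j @^-1` ball (ratr (z.1 j) : R) z.2.+1%:R^-1).
have mbox z : measurable (box z).
  apply: fin_bigcap_measurable => // j _; rewrite -[X in measurable X]setTI.
  apply: measurable_colvec_coord => //; exact: measurable_ball.
pose F z := if `[< X `&` box z `<=` U >] then X `&` box z else set0.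
have -> : U = \bigcup_z F z.
  apply/seteqP; split=> [x Ux|x [z _]]; last first.
    by rewrite /F; case: asboolP => // h /h.
  have [r r0 hr] := hU x Ux.
  have [l hl] : exists l : nat, 2 * l.+1%:R^-1 < r.
    exists (Num.truncn (2 / r));
      rewrite -ltr_pdivlMl// -[ltRHS]invrK ltf_pV2 ?posrE//.
      by rewrite invfM invrK mulrC truncnS_gt.
    by rewrite invr_gt0 mulr_gt0// invr_gt0.
  have l0 : 0 < l.+1%:R^-1 :> R by rewrite invr_gt0.
  have /choice[c hc] (j : 'I_m) : exists q : rat, `|ratr q - x j 0| < l.+1%:R^-1.
    have : x j 0 - l.+1%:R^-1 < x j 0 + l.+1%:R^-1.
      by rewrite ltrD2l (lt_trans _ l0)// oppr_lt0.
    move=> /rat_in_itvoo[q]; rewrite in_itv/= => hq.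
    by exists q; rewrite ltr_distl.
  exists ([ffun j => c j], l) => //.
  have bx : box ([ffun j => c j], l) x.
    by move=> j _; rewrite /= /ball/= ffunE; exact: hc.
  rewrite /F; case: asboolP => [_|]; first by split=> //; exact: UX.
  case=> y [Xy by_]; apply: hr => // j.
  have := by_ j I; rewrite /= /ball/= ffunE => h1; have := hc j;
    rewrite distrC => h2.
  rewrite -(subrK (ratr (c j)) (x j 0)) -addrA.
  apply: le_lt_trans (ler_normD _ _) _; apply: lt_trans hl.
  by rewrite mulr_natl mulr2n ltrD.
apply: countable_bigcupT_measurable; first exact: countableP.
by move=> z; rewrite /F; case: asboolP => // _; exact: measurableI.
Qed.

Lemma measurable_differentiable_on X f : measurable X -> differentiable_on X f ->
  measurable_fun X f.
Proof.
move=> mX df _; apply: (measurability _ (RGenOInfty.measurableE R)) => //.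
move=> /= _ [_ [a ->] <-]; apply: (measurable_relatively_open mX).
  exact: subIsetl.
move=> x [Xx]; rewrite /= in_itv/= andbT => afx.
have fa0 : 0 < f x - a by rewrite subr_gt0.
have [r r0 hr] := within_differential_continuous Xx fa0 (df x Xx).
exists r => // y Xy hy; split=> //; rewrite /= in_itv/= andbT.
by have := hr y Xy hy; rewrite distrC => /(le_lt_trans (ler_norm _)); lra.
Qed.

End density_support.

Section gradient_measurable.
Context {R : realType} {m : nat}.
Implicit Types (X : set 'cV[R]_m) (rho f : 'cV[R]_m -> R) (x y : 'cV[R]_m).

Lemma measurable_hyperplane (i : 'I_m) (a : R) :
  measurable [set x : 'cV[R]_m | x i 0 = a].
Proof.
rewrite (_ : [set x | _] = colvec_coord i @^-1` [set a])//.
by rewrite -[X in measurable X]setTI; exact: measurable_colvec_coord.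
Qed.

Lemma lebesgue_colvec_hyperplane (i : 'I_m) (a : R) :
  lebesgue_colvec m [set x : 'cV[R]_m | x i 0 = a] = 0%E.
Proof.
pose B j : set (measurableTypeR R) := if j == i then [set a] else setT.
have mB j : measurable (B j) by rewrite /B; case: (j == i).
have -> : [set x : 'cV[R]_m | x i 0 = a] =
  [set x : 'cV[R]_m | forall j, B j (x j 0)].
  apply/seteqP; split=> x /= => [xa j|h].
    by rewrite /B; case: (eqVneq j i) => // ->.
  by have := h i; rewrite /B eqxx.
rewrite lebesgue_colvec_box// (bigD1 i)//= {1}/B eqxx.
by rewrite lebesgue_measure_set1 mul0e.
Qed.

Lemma exists_invS_lt (r : R) : 0 < r -> exists l : nat, l.+1%:R^-1 < r.
Proof.
move=> r0; exists (Num.truncn r^-1).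
by rewrite -[ltRHS]invrK ltf_pV2 ?posrE ?invr_gt0// truncnS_gt.
Qed.

(* A point of [X] whose [i]-th coordinate is isolated in the [i]-th projection
   of [X] lies on one of countably many hyperplanes; elsewhere the gradient is
   determined by the difference quotients along a countable set of increments. *)
Lemma measurable_gradient X rho f : density_on X rho -> separable rho ->
  differentiable_on X f ->
  exists Z : set 'cV[R]_m, [/\ measurable Z, lebesgue_colvec m Z = 0%E &
    forall i, measurable_fun (X `\` Z) (fun x => gradient X f x i 0)].
Proof.
move=> hrho hsep df.
have mX := measurable_density_support hrho.
have [x0 Xx0] := density_support_neq0 hrho.
(* A chosen point of the projection in each rational interval, or a coordinate of [x0] if there is
   none. When the interval isolates a point of the projection, that point is the one chosen, so the
   hyperplanes [x z.1 0 = a z] catch all isolated coordinates. *)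
pose a (z : 'I_m * (rat * rat)) : R := xget (x0 z.1 0)
  [set t | (exists2 y, X y & y z.1 0 = t) /\ ratr z.2.1 < t < ratr z.2.2].
have aX z x : X x -> X (set_coord z.1 x (a z)).
  move=> Xx; have [y Xy <-] : exists2 y, X y & y z.1 0 = a z.
    by rewrite /a; case: xgetP => [t _ []//|_]; exists x0.
  exact: density_support_set_coord hrho hsep Xx Xy.
pose F (n : nat) := if unpickle n is Some z
  then [set x : 'cV[R]_m | x z.1 0 = a z] else set0.
have mF n : measurable (F n).
  by rewrite /F; case: unpickle => // z; exact: measurable_hyperplane.
have F0 n : lebesgue_colvec m (F n) = 0%E.
  by rewrite /F; case: unpickle => [z|];
    [exact: lebesgue_colvec_hyperplane|exact: measure0].
pose Z := \bigcup_n F n.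
have mZ : measurable Z by exact: bigcupT_measurable.
have ZE x z : ~ Z x -> x z.1 0 <> a z.
  by move=> nZ xa; apply: nZ; exists (pickle z) => //; rewrite /F pickleK.
exists Z; split => //.
  apply: measure_negligible => //; apply: negligible_bigcup => n.
  by exists (F n); split => //; exact: F0.
move=> i; have mXZ : measurable (X `\` Z) by exact: measurableD.
move=> _; apply: (measurability _ (RGenCInfty.measurableE R)) => //.
move=> /= _ [_ [c ->] <-].
have mf : measurable_fun setT (f \_ X).
  by apply/(measurable_restrictT _ mX); exact: measurable_differentiable_on.
pose g := f \_ X.
pose h (q : rat * rat) x := a (i, q) - x i 0.
(* The implication: if the increment to [a (i, q)] is at most [1/(l+1)], then the difference
   quotient is at least [c - 1/(k+1)]. For all [k], some [l] and all [q], this expresses that the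
   partial derivative is at least [c]. *)
pose E (k l : nat) q : set 'cV[R]_m :=
  [set x | 0 <= l.+1%:R^-1 - `|h q x| ] `&` [set x | 0 <=
    (g (set_coord i x (a (i, q))) - g x) * h q x - (c - k.+1%:R^-1) * h q x ^+ 2]
  `|` ~` [set x | 0 <= l.+1%:R^-1 - `|h q x| ].
have mh q : measurable_fun setT (h q).
  by apply: measurable_funB;
    [exact: measurable_cst|exact: (measurable_colvec_coord i)].
have mE k l q : measurable (E k l q).
  have m1 : measurable [set x | 0 <= l.+1%:R^-1 - `|h q x| ].
    apply: measurable_ge0_set; apply: measurable_funB; first exact: measurable_cst.
    exact: measurableT_comp.
  apply: measurableU; last exact: measurableC.
  apply: measurableI => //; apply: measurable_ge0_set.
  apply: measurable_funB; apply: measurable_funM => //.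
  - apply: measurable_funB => //.
    exact: (measurableT_comp mf (measurable_set_coord i (a (i, q)))).
  - exact: measurable_funX.
have -> : (X `\` Z) `&` ((fun x => gradient X f x i 0) @^-1` `[c, +oo[) =
    (X `\` Z) `&` \bigcap_k \bigcup_l \bigcap_q E k l q.
  have gX z : X z -> g z = f z by move=> Xz; rewrite /g patchE mem_set.
  apply/seteqP; split=> x [[Xx nZx]] /=; rewrite ?in_itv/= ?andbT => hx.
    split=> // k _; have k0 : 0 < k.+1%:R^-1 :> R by rewrite invr_gt0.
    have [r r0 hr] := gradient_quotient i Xx k0 (df x Xx).
    have [l hl] := exists_invS_lt r0.
    exists l => // q _; have [hq|hq] := leP `|h q x| l.+1%:R^-1; [left|right].
      split=> /=; first by rewrite subr_ge0.
      have := hr (a (i, q)) (aX (i, q) x Xx) (le_lt_trans hq hl).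
      rewrite !gX//; last exact: (aX (i, q)).
      rewrite -/(h q x) ler_norml => /andP[hq1 _].
      have h0 : 0 <= gradient X f x i 0 - c by rewrite subr_ge0.
      have := mulr_ge0 h0 (sqr_ge0 (h q x)).
      by move: hq1; rewrite /=; move: (k.+1%:R^-1 : R) => e; lra.
    by rewrite /= subr_ge0 leNgt hq.
  split=> //; rewrite leNgt; apply/negP => Gc.
  set G := gradient X f x i 0 in Gc.
  have e0 : 0 < (c - G) / 2 by rewrite divr_gt0// subr_gt0.
  have [k hk] := exists_invS_lt e0; have [l _ hl] := hx k I.
  have [r r0 hr] := gradient_quotient i Xx e0 (df x Xx).
  have l0 : 0 < l.+1%:R^-1 :> R by rewrite invr_gt0.
  (* A rational interval around [x i 0] within distance [b] contains its chosen point, which differs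
     from [x i 0] off [Z]: this is a nonzero increment small enough for both estimates. *)
  pose b := Num.min r l.+1%:R^-1; have b0 : 0 < b by rewrite lt_min r0.
  have /rat_in_itvoo[p1] : x i 0 - b < x i 0 by rewrite ltrBlDr ltrDl.
  have /rat_in_itvoo[p2] : x i 0 < x i 0 + b by rewrite ltrDl.
  rewrite !in_itv/= => /andP[xp2 p2b] /andP[bp1 p1x].
  have : ratr p1 < a (i, (p1, p2)) < ratr p2.
    rewrite /a; case: xgetP => [t _ []//|/(_ (x i 0))[]].
    by split; [exists x|rewrite /= p1x].
  move=> /andP[p1a ap2].
  have := ZE x (i, (p1, p2)) nZx; have := aX (i, (p1, p2)) x Xx.
  have := hl (p1, p2) I; set t := a _ in p1a ap2 * => hE Xt /= xt.
  have ht : `|t - x i 0| < b by rewrite ltr_distl (lt_trans bp1 p1a)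
    (lt_trans ap2 p2b).
  move: (ht); rewrite lt_min => /andP[tr tl].
  have {}hE : (c - k.+1%:R^-1) * (t - x i 0) ^+ 2 <=
      (f (set_coord i x t) - f x) * (t - x i 0).
    case: hE => [[_]|]; last by rewrite /= subr_ge0 /h -/t (ltW tl).
    by rewrite /= subr_ge0 /h -/t !gX.
  have := hr t Xt tr; rewrite ler_norml -/G => /andP[_].
  have : 0 < (t - x i 0) ^+ 2.
    by rewrite exprn_even_gt0//= subr_eq0; apply/eqP => /esym.
  by move: hE hk; move: (k.+1%:R^-1 : R) => e; nra.
apply: measurableI => //; apply: bigcapT_measurable => k.
apply: bigcupT_measurable => l.
rewrite -[X in measurable X]setCK; apply: measurableC; rewrite setC_bigcap.
apply: countable_bigcupT_measurable; first exact: countableP.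
by move=> q; exact: measurableC.
Qed.

End gradient_measurable.

(** * Densities and null sets *)

Section null_sets.
Context d (T : measurableType d) (R : realType) (mu : {measure set T -> \bar R}).
Variable Z : set T.
Hypotheses (mZ : measurable Z) (Z0 : mu Z = 0%E).

(* The gradient may fail to be measurable on a null set, which rules out
   [ae_eq_integral]. *)
Let ge0_integral_null_le (f g : T -> \bar R) :
  (forall x, 0 <= f x)%E -> (forall x, 0 <= g x)%E ->
  (forall x, ~ Z x -> f x = g x) ->
  (\int[mu]_x f x <= \int[mu]_x g x)%E.
Proof.
move=> f0 g0 fg; rewrite (ge0_integralTE mu f0) (ge0_integralTE mu g0).
apply: ub_ereal_sup => _ [h /= hf <-].
pose h' := proj_nnsfun h (measurableC mZ).
have h'E x : h' x = h x * \1_(~` Z) x by [].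
have h'Z x : ~ Z x -> h' x = h x.
  by move=> nZ; rewrite h'E indicE mem_set ?mulr1.
apply: ereal_sup_ubound; exists h' => //.
  move=> x; change (((h' x)%:E <= g x)%E); have [Zx|nZ] := pselect (Z x);
    last by rewrite -fg// h'Z.
  by rewrite h'E indicE memNset ?mulr0//= => /(_ Zx).
have mE (u : {nnsfun T >-> R}) :
    sintegral mu u = (\int[mu]_(x in setT `\` Z) (u x)%:E)%E.
  rewrite -(@ge0_negligible_integral _ _ _ mu setT Z (EFin \o u))//.
  - by rewrite integral_nnsfun// patch_setT.
  - exact/measurable_EFinP.
  - by move=> x _; rewrite lee_fin.
rewrite !mE; apply: eq_integral => x; rewrite inE => -[_ nZ].
by rewrite h'Z.
Qed.

Lemma integral_null_set (f g : T -> \bar R) : (forall x, ~ Z x -> f x = g x) ->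
  (\int[mu]_x f x = \int[mu]_x g x)%E.
Proof.
move=> fg; rewrite integralE [RHS]integralE; congr (_ - _)%E.
  apply/eqP; rewrite eq_le; apply/andP; split;
    apply: ge0_integral_null_le => // x nZ;
    by rewrite !funeposE fg.
apply/eqP; rewrite eq_le; apply/andP; split; apply: ge0_integral_null_le => // x nZ;
  by rewrite !funenegE fg.
Qed.

End null_sets.

Section densities.
Context {R : realType} {m : nat} {d : measure_display} {T : measurableType d}.
Context {P : probability T R} (x : {RV P >-> 'cV[R]_m}).
Context (X : set 'cV[R]_m) (rho : 'cV[R]_m -> R).
Hypotheses (hrho : density_on X rho) (hx : has_density rho x).

Lemma density_ge0 y : 0 <= rho y.
Proof.
have [_ pos out _ _] := hrho; have [Xy|nXy] := pselect (X y).
  exact: ltW (pos y Xy).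
by rewrite out.
Qed.

Lemma integrable_density : (lebesgue_colvec m).-integrable setT (EFin \o rho).
Proof.
have [mrho _ _ _ int1] := hrho; apply/integrableP; split.
  exact/measurable_EFinP.
under eq_integral do rewrite /= ger0_norm ?density_ge0//.
by rewrite int1 ltry.
Qed.

Lemma integrable_bdd_density h : bdd_meas h ->
  (lebesgue_colvec m).-integrable setT (EFin \o (fun y => h y * rho y)).
Proof.
move=> [mh [M hM]]; have [mrho _ _ _ _] := hrho.
apply: (@le_integrable _ _ _ _ _ _ _ (fun y => (`|M| * rho y)%:E)) => //.
- by apply/measurable_EFinP; exact: measurable_funM.
- move=> y _; rewrite /= lee_fin !normrM normr_id ler_wpM2r//.
  exact: le_trans (hM y) (ler_norm M).
- exact: integrableZl integrable_density.
Qed.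

(** Indicators are the content of [has_density]; [bdd_meas_ext] reaches bounded measurable
    functions, the difference of the two sides being linear and bounded. *)
Lemma Ex_density h : bdd_meas h ->
  Ex P (fun w => h (x w)) = \int[lebesgue_colvec m]_y (h y * rho y).
Proof.
have bhx g : bdd_meas g -> bdd_meas (fun w => g (x w)).
  by move=> bg; exact: (bdd_meas_comp (measurable_funPT x) bg).
pose I (g : 'cV[R]_m -> R) : R := \int[lebesgue_colvec m]_y (g y * rho y).
move=> bh; apply/eqP; rewrite -subr_eq0 -mulN1r; apply/eqP.
apply: (@bdd_meas_ext _ _ _ (fun g => Ex P (fun w => g (x w)) + -1 * I g)
  (1 + I (fun=> 1))) => //.
- move=> f g bf bg; rewrite /I ExD; [|exact: bhx..].
  under eq_Rintegral do rewrite mulrDl.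
  by rewrite RintegralD//; [ring|exact: integrable_bdd_density..].
- move=> a f bf; rewrite /I ExZ; last exact: bhx.
  under eq_Rintegral do rewrite -mulrA.
  by rewrite RintegralZl//; [ring|exact: integrable_bdd_density].
- move=> f c bf hf; rewrite mulrDl mul1r; apply: le_trans (ler_normD _ _) _.
  apply: lerD; first by apply: Ex_norm_le; [exact: bhx|move=> w; exact: hf].
  rewrite mulN1r normrN mulrC -RintegralZl//; last first.
    by apply: integrable_bdd_density; exact: bdd_meas_cst.
  apply: le_trans (le_normr_Rintegral _ (integrable_bdd_density bf)) _ => //.
  apply: le_Rintegral => //.
  - exact/integrable_norm/integrable_bdd_density.
  - have i1 := integrable_bdd_density (bdd_meas_cst 1).
    exact: (integrableZl measurableT c i1).
  - move=> y _; rewrite mul1r normrM (ger0_norm (density_ge0 y)) ler_wpM2r//.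
    exact: density_ge0.
- move=> B mB; rewrite mulN1r; apply/eqP; rewrite subr_eq0; apply/eqP.
  have mxB : measurable (x @^-1` B).
    by rewrite -[X in measurable X]setTI; exact: measurable_funPT.
  apply: EFin_inj; rewrite -[fun w => \1_B (x w)]/(\1_B \o x).
  transitivity (P (x @^-1` B)).
    by rewrite -Ex_indic//; congr (Ex P _)%:E; apply/funext => w; rewrite !indicE.
  have := hx mB; rewrite /distribution/= /pushforward => ->.
  rewrite /I /Rintegral fineK; last first.
    apply: integrable_fin_num => //.
    by apply: (integrable_bdd_density); exact: bdd_meas_indic.
  rewrite [LHS]integral_mkcond; apply: eq_integral => y _.
  by rewrite patchE indicE; case: ifP => _; rewrite ?mul1r ?mul0r.
Qed.

Lemma density_null_set B : measurable B -> (forall y, B y -> rho y = 0) ->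
  P (x @^-1` B) = 0%E.
Proof.
move=> mB h; have := hx mB; rewrite /distribution/= /pushforward => ->.
by rewrite integral0_eq// => y By; rewrite h.
Qed.

Lemma density_lebesgue_null B : measurable B -> lebesgue_colvec m B = 0%E ->
  P (x @^-1` B) = 0%E.
Proof.
move=> mB B0; have := hx mB; rewrite /distribution/= /pushforward => ->.
apply: null_set_integral => //.
by have [mrho _ _ _ _] := hrho; apply/measurable_EFinP; exact: measurable_funTS.
Qed.

End densities.

(** * Concentration of sample covariances *)

Section covariance_concentration.
Context {R : realType} {m q N : nat} {d : measure_display} {T : measurableType d}.
Context {P : probability T R} (x : 'I_N -> {RV P >-> 'cV[R]_m}).
Context (G : 'cV[R]_m -> 'cV[R]_q) (C V : 'M[R]_q) (L : R).
Hypothesis hind : independent_samples x.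
Hypothesis bG : forall a, bdd_meas (fun y => G y a 0).
Hypothesis GL : forall y, enorm (G y) <= L.
Let Y y := G y *m (G y)^T.
Let D y := Y y - C.
Hypothesis EY : forall j, ExM P (fun w => Y (x j w)) = C.
Hypothesis ED : forall j, ExM P (fun w => D (x j w) *m D (x j w)) = V.
Hypothesis N0 : (0 < N)%N.

Let L0 : 0 <= L. Proof. exact: le_trans (enorm_ge0 _) (GL 0). Qed.

Let bY a b : bdd_meas (fun y => Y y a b).
Proof.
by under eq_fun do rewrite mxE big_ord_recl big_ord0 addr0 !mxE; exact: bdd_measM.
Qed.

Let bD a b : bdd_meas (fun y => D y a b).
Proof.
under eq_fun do rewrite mxE; apply: bdd_measD => //.
exact: bdd_meas_cst.
Qed.

Let dotY u v y : dot u (Y y *m v) = dot u (G y) * dot (G y) v.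
Proof.
have -> : Y y *m v = dot (G y) v *: G y.
  by rewrite /Y -mulmxA [_^T *m v]mx11_scalar mul_mx_scalar.
by rewrite dotZr mulrC.
Qed.

Let dotY_le u v y : `|dot u (Y y *m v)| <= L ^+ 2 * (enorm u * enorm v).
Proof.
have -> : L ^+ 2 * (enorm u * enorm v) = (enorm u * L) * (L * enorm v) by ring.
rewrite dotY normrM; apply: ler_pM => //; apply: le_trans (cauchy_schwarz _ _) _.
  by rewrite ler_wpM2l ?enorm_ge0.
by rewrite ler_wpM2r ?enorm_ge0.
Qed.

Let opboundY y : opbound (Y y) (L ^+ 2).
Proof.
apply: opbound_dot; first exact: sqr_ge0.
by move=> u v; exact: le_trans (ler_norm _) (dotY_le _ _ _).
Qed.

Let opboundC : opbound C (L ^+ 2).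
Proof.
apply: opbound_dot => [|u v]; first exact: sqr_ge0.
rewrite -(EY (Ordinal N0)) dot_ExM; last by move=> a b;
  exact: (bdd_meas_RV x _ (bY a b)).
apply: le_trans (ler_norm _) (Ex_norm_le _ _ _) => [|w]; last exact: dotY_le.
apply: (closed_dot (@bdd_meas_cst _ _ T) (@bdd_measD _ _ T) (@bdd_measM _ _ T)).
by move=> a b; exact: (bdd_meas_RV x _ (bY a b)).
Qed.

Let trY y : (Y y)^T = Y y. Proof. by rewrite /Y trmx_mul trmxK. Qed.

Let trC : C^T = C.
Proof.
rewrite -(EY (Ordinal N0)); apply/matrixP => a b; rewrite !mxE.
by congr (Ex P _); apply/funext => w; rewrite -[in LHS]trY mxE.
Qed.

Let trD y : (D y)^T = D y.
Proof. by rewrite /D linearB/= trY trC. Qed.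

Let opboundD2 y : opbound (D y) (2 * L ^+ 2).
Proof.
rewrite /D mulrDl mul1r; apply: opboundD => // v.
by rewrite -scaleN1r -scalemxAl enormZ normrN1 mul1r.
Qed.

Let bDx j a b : bdd_meas (fun w => D (x j w) a b).
Proof. exact: (bdd_meas_RV x j (bD a b)). Qed.

Let EMZ (F : T -> 'M[R]_q) a : (forall i j, bdd_meas (fun w => F w i j)) ->
  ExM P (fun w => a *: F w) = a *: ExM P F.
Proof.
move=> bF; apply/matrixP => i j; rewrite !mxE.
by under eq_fun do rewrite mxE; rewrite ExZ.
Qed.

Let EMD j : ExM P (fun w => D (x j w)) = 0.
Proof.
apply/matrixP => a b; rewrite !mxE.
have -> : (fun w => D (x j w) a b) = fun w => Y (x j w) a b + - C a b.
  by apply/funext => w; rewrite [LHS]mxE; congr (_ + _); rewrite mxE.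
rewrite ExD; [|exact: (bdd_meas_RV x j (bY a b))|exact: bdd_meas_cst].
have := congr1 (fun M : 'M[R]_q => M a b) (EY j).
by rewrite mxE Ex_cst => ->; rewrite subrr.
Qed.

Let ED2 j u : Ex P (fun w => dot (D (x j w) *m u) (D (x j w) *m u)) <=
  opnorm V * dot u u.
Proof.
have -> : Ex P (fun w => dot (D (x j w) *m u) (D (x j w) *m u)) = dot u (V *m u).
  rewrite -(ED j) dot_ExM.
    congr (Ex P _); apply/funext => w.
    by rewrite dot_mulmxl trD mulmxA.
  exact: (closed_mulmx (@bdd_meas_cst _ _ T) (@bdd_measD _ _ T) (@bdd_measM _ _ T)).
apply: le_trans (ler_norm _) (le_trans (cauchy_schwarz _ _) _).
rewrite -sqr_enorm expr2 mulrCA ler_wpM2l ?enorm_ge0//.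
exact: opbound_opnorm.
Qed.

(** The factor [2 * delta] in [a] normalizes [D] to norm at most 1. The extra [expR 1] makes the
    variance cost at most [N eta / (4 e delta)], half of the gain [N |a| eta]. Both signs of [a] are
    used, for the upper and the lower bound. *)
Let scaled_tail (a eta delta : R) : 0 < eta -> 0 < delta ->
  L ^+ 2 <= delta -> opnorm V <= eta * delta ->
  `|a| = (2 * expR 1 * delta)^-1 ->
  exists2 A : set T, measurable A &
    (P (~` A) <= (2 * q%:R * expR (1 - N%:R * eta / (4 * expR 1 * delta)))%:E)%E /\
    forall w, A w -> forall u,
      a * dot u ((\sum_j D (x j w)) *m u) <= N%:R * `|a| * eta * dot u u.
Proof.
move=> eta0 delta0 Ld Vd aE.
set kappa := expR 1 in aE *; have k1 : 1 <= kappa by rewrite -expR0 ler_expR.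
have k0 : 0 < kappa by exact: expR_gt0.
have kd0 : 0 < kappa * delta by rewrite mulr_gt0.
pose H y := a *: D y.
have bH i j : bdd_meas (fun y => H y i j).
  by under eq_fun do rewrite mxE; exact: bdd_measZ.
have sH y : (H y)^T = H y by rewrite /H linearZ/= trD.
have oH y : opbound (H y) 1.
  apply: opbound_le (opboundZ a (opboundD2 y)).
  rewrite aE ler_pdivrMl ?mulr_gt0// mulr1 -mulrA ler_wpM2l//.
  by apply: le_trans Ld _; rewrite ler_peMl// ltW.
have EH j : ExM P (fun w => H (x j w)) = 0 by rewrite EMZ// EMD scaler0.
have V0 : 0 <= opnorm V := opnorm_ge0 V.
have EHH j u : Ex P (fun w => dot (H (x j w) *m u) (H (x j w) *m u)) <=
    a ^+ 2 * opnorm V * dot u u.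
  have -> : (fun w => dot (H (x j w) *m u) (H (x j w) *m u)) =
      fun w => a ^+ 2 * dot (D (x j w) *m u) (D (x j w) *m u).
    by apply/funext => w; rewrite /H -scalemxAl dotZl dotZr mulrA expr2.
  rewrite ExZ; last first.
    under eq_fun do rewrite dot_mulmxl trD mulmxA.
    apply: (closed_dot (@bdd_meas_cst _ _ T) (@bdd_measD _ _ T) (@bdd_measM _ _ T)).
    exact: (closed_mulmx (@bdd_meas_cst _ _ T) (@bdd_measD _ _ T)
      (@bdd_measM _ _ T)).
  by rewrite -mulrA ler_wpM2l ?sqr_ge0.
have s0 : 0 <= a ^+ 2 * opnorm V by rewrite mulr_ge0 ?sqr_ge0.
have t0 : 0 <= N%:R * `|a| * eta by rewrite !mulr_ge0// ltW.
have [A mA [PA hA]] := matrix_bernstein hind bH sH oH EH EHH s0 t0.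
exists A => //; split; last first.
  move=> w Aw u; have := hA w Aw u.
  by rewrite /H -scaler_sumr -scalemxAl dotZr.
apply: le_trans PA _; rewrite lee_fin ler_wpM2l ?mulr_ge0// ler_expR.
rewrite -/kappa.
have -> : a ^+ 2 = (2 * kappa * delta)^-1 ^+ 2 by rewrite -aE real_normK ?num_real.
rewrite aE.
have -> : N%:R * (kappa * ((2 * kappa * delta)^-1 ^+ 2 * opnorm V)) =
    N%:R / (4 * kappa * delta) * (opnorm V / delta).
  by field; rewrite !gt_eqF.
have -> : N%:R / (2 * kappa * delta) * eta = N%:R / (4 * kappa * delta) * (2 * eta).
  by field; rewrite !gt_eqF.
have -> : N%:R * eta / (4 * kappa * delta) = N%:R / (4 * kappa * delta) *
  eta by ring.
have : opnorm V / delta <= eta by rewrite ler_pdivrMr.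
have : 0 <= N%:R / (4 * kappa * delta) by rewrite divr_ge0// !mulr_ge0// ltW.
set p := N%:R / _; set v := opnorm V / _; nra.
Qed.

Lemma covariance_concentration (eta delta : R) : 0 < eta -> 0 < delta ->
  L ^+ 2 <= delta -> opnorm V <= eta * delta ->
  exists2 A : set T, measurable A &
    (P (~` A) <= (4 * q%:R * expR (1 - N%:R * eta / (4 * expR 1 * delta)))%:E)%E /\
    forall w, A w -> opbound (N%:R^-1 *: (\sum_j Y (x j w)) - C) eta.
Proof.
move=> eta0 delta0 Ld Vd; pose a := (2 * expR 1 * delta)^-1.
have a0 : 0 < a by rewrite invr_gt0 !mulr_gt0 ?expR_gt0.
have [|A1 mA1 [PA1 hA1]] := scaled_tail (a := a) eta0 delta0 Ld Vd.
  by rewrite gtr0_norm.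
have [|A2 mA2 [PA2 hA2]] := scaled_tail (a := - a) eta0 delta0 Ld Vd.
  by rewrite normrN gtr0_norm.
exists (A1 `&` A2); first exact: measurableI.
have NR : 0 < N%:R :> R by rewrite ltr0n.
split.
  rewrite setCI; apply: (@le_trans _ _ (P (~` A1) + P (~` A2))%E).
    by apply: measureU2; exact: measurableC.
  apply: le_trans (leeD PA1 PA2) _; rewrite -EFinD lee_fin; set b := expR _.
  by rewrite -mulrDl -mulrDl -natrD.
move=> w [A1w A2w].
have -> : N%:R^-1 *: (\sum_j Y (x j w)) - C = N%:R^-1 *: \sum_j D (x j w).
  rewrite /D sumrB scalerBr sumr_const card_ord -(scaler_nat N C) scalerA mulVf
    ?scale1r//.
  by rewrite gt_eqF.
apply: sym_opbound; first exact: ltW.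
  by rewrite linearZ/= linear_sum/=; congr (_ *: _); apply: eq_bigr => j _.
move=> u; rewrite -scalemxAl dotZr normrM gtr0_norm ?invr_gt0// ler_pdivrMl//.
have := hA1 w A1w u; have := hA2 w A2w u.
rewrite normrN (gtr0_norm a0) mulNr; set s := dot u _ => h2 h1.
rewrite ler_norml; apply/andP; split.
  by rewrite -(ler_pM2l a0); lra.
by rewrite -(ler_pM2l a0); lra.
Qed.

End covariance_concentration.

(** * The gradient at the sampled points *)

Section sampled_gradient.
Context {R : realType} {m : nat} {d : measure_display} {T : measurableType d}.
Context {P : probability T R} (X Z : set 'cV[R]_m) (rho f : 'cV[R]_m -> R) (L : R).
Hypothesis hrho : density_on X rho.
Hypotheses (mZ : measurable Z) (Z0 : lebesgue_colvec m Z = 0%E).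
Hypothesis mgrad : forall i, measurable_fun (X `\` Z) (fun y => gradient X f y i 0).
Hypothesis hL : forall y, X y -> enorm (gradient X f y) <= L.

(** Setting the gradient to zero off [X] and on the exceptional null set makes it measurable and
    bounded on the whole space, as the concentration argument requires; almost surely no sample sees
    the change. *)
Definition regular_gradient (y : 'cV[R]_m) : 'cV[R]_m :=
  if y \in X `\` Z then gradient X f y else 0.
Local Notation G := regular_gradient.

Lemma regular_gradientE y : (X `\` Z) y -> G y = gradient X f y.
Proof. by move=> XZy; rewrite /G mem_set. Qed.

Lemma regular_gradient_le y : enorm (G y) <= L.
Proof.
have [x0 Xx0] := density_support_neq0 hrho.
have L0 : 0 <= L := le_trans (enorm_ge0 _) (hL Xx0).
rewrite /G; case: ifPn => [|_]; last by rewrite enorm0.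
by rewrite inE => -[Xy _]; exact: hL.
Qed.

Lemma bdd_meas_regular_gradient i : bdd_meas (fun y => G y i 0).
Proof.
split.
  rewrite (_ : (fun y => _) = (fun y => gradient X f y i 0) \_ (X `\` Z)).
    have mXZ := measurableD (measurable_density_support hrho) mZ.
    by apply/(measurable_restrictT _ mXZ).
  by apply/funext => y; rewrite patchE /G; case: ifP => _ //; rewrite mxE.
exists L => y; apply: le_trans (regular_gradient_le y).
rewrite enormE dotE (bigD1 i)//= -expr2 -[leLHS]sqrtr_sqr ler_wsqrtr//.
by rewrite lerDl sumr_ge0// => j _; rewrite -expr2 sqr_ge0.
Qed.

Lemma Ex_off_null (x : {RV P >-> 'cV[R]_m}) (F h : 'cV[R]_m -> R) :
  has_density rho x -> bdd_meas h -> (forall y, (X `\` Z) y -> h y = F y) ->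
  Ex P (fun w => h (x w)) = \int[lebesgue_colvec m]_(y in X) (F y * rho y).
Proof.
move=> hx bh hF; rewrite (Ex_density hrho hx bh) /Rintegral; congr fine.
rewrite [RHS]integral_mkcond; apply: (integral_null_set mZ Z0) => y nZ.
rewrite patchE; case: ifPn => [|].
  by rewrite inE => Xy; rewrite hF.
by rewrite notin_setE => nX; have [_ _ out _ _] := hrho; rewrite out// mulr0.
Qed.

Lemma ExM_off_null (x : {RV P >-> 'cV[R]_m}) (F H : 'cV[R]_m -> 'M[R]_m) :
  has_density rho x -> (forall a b, bdd_meas (fun y => H y a b)) ->
  (forall y, (X `\` Z) y -> H y = F y) ->
  ExM P (fun w => H (x w)) = integral_mx X rho F.
Proof.
move=> hx bH HF; apply/matrixP => a b; rewrite !mxE.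
by apply: (Ex_off_null (F := fun y => F y a b) hx (bH a b)) => y XZy; rewrite HF.
Qed.

Lemma sample_regular (x : {RV P >-> 'cV[R]_m}) : has_density rho x ->
  measurable (x @^-1` (X `\` Z)) /\ P (~` (x @^-1` (X `\` Z))) = 0%E.
Proof.
move=> hx; have mX := measurable_density_support hrho.
have mpre B : measurable B -> measurable (x @^-1` B).
  by move=> mB; rewrite -[X in measurable X]setTI; exact: measurable_funPT.
have mXZ := measurableD mX mZ.
split; first exact: mpre.
rewrite preimage_setC setDE setCI setCK preimage_setU.
apply/eqP; rewrite eq_le measure_ge0 andbT.
apply: le_trans (measureU2 _ (mpre _ (measurableC mX)) (mpre _ mZ)) _.
have [_ _ out _ _] := hrho.
have e1 := density_null_set hx (measurableC mX) out.
have e2 := density_lebesgue_null hrho hx mZ Z0.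
rewrite [X in (X + _)%E](_ : _ = 0%E); last exact: e1.
by rewrite [X in (_ + X)%E](_ : _ = 0%E) ?adde0.
Qed.

End sampled_gradient.

(** The three summands of the constant: [beta] yields the power of [m], 2 yields the division by
    [(2 * m) ^+ 2] that outweighs [4 * m], and the inverse of [ln 2] absorbs the 1 in the exponent,
    since [ln (2 * m)] is at least [ln 2]. *)
Lemma failure_bound (R : realType) (beta : R) (m : nat) (u : R) : 0 < beta ->
  (1 < m)%N ->
  (beta + 2 + (ln 2)^-1) * ln (2 * m)%:R <= u ->
  4 * m%:R * expR (1 - u) <= m%:R `^ (- beta) :> R.
Proof.
move=> beta0 m1 hu; have m0 : 0 < m%:R :> R by rewrite ltr0n ltnW.
have m1R : 1 <= m%:R :> R by rewrite ler1n ltnW.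
rewrite natrM in hu; set v := ln (2 * m%:R) in hu.
have ln2 : 0 < ln 2 :> R by rewrite ln_gt0// ltr1n.
have v2 : ln 2 <= v by rewrite ler_ln ?posrE ?mulr_gt0// ler_peMr.
have vm : ln m%:R <= v by rewrite ler_ln ?posrE ?mulr_gt0// ler_peMl// ler1n.
have v1 : 1 <= (ln 2)^-1 * v by rewrite ler_pdivlMl// mulr1.
apply: (@le_trans _ _ (4 * m%:R * expR (- (beta * v) - 2 * v))).
  by rewrite ler_wpM2l ?mulr_ge0// ler_expR; lra.
have -> : expR (- (beta * v) - 2 * v) = expR (- (beta * v)) / (2 * m%:R) ^+ 2.
  by rewrite expRD (expRN (2 * v)); congr (_ / _);
    rewrite expRM_natl lnK ?posrE ?mulr_gt0.
have -> : 4 * m%:R * (expR (- (beta * v)) / (2 * m%:R) ^+ 2) =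
    expR (- (beta * v)) / m%:R.
  by field; rewrite gt_eqF.
rewrite /powR gt_eqF// ler_pdivrMr//.
apply: (@le_trans _ _ (expR (- beta * ln m%:R))).
  by rewrite ler_expR mulNr lerN2 ler_wpM2l// ltW.
by rewrite ler_peMr// expR_ge0.
Qed.

Theorem corollary3p7 (R : realType) (beta : R) (hbeta : 0 < beta) :
  exists2 c : R, 0 < c &
  forall (m n N : nat) (hm : (1 < m)%N) (hn : (1 <= n)%N) (hnm : (n < m)%N)
    (X : set 'cV[R]_m) (rho f : 'cV[R]_m -> R)
    (hX : centered_same_range X)
    (hrho : density_on X rho) (hsep : separable rho)
    (hdiff : differentiable_on X f) (hac : absolutely_continuous_on X f)
    (W : 'M[R]_m) (lam : nat -> R)
    (hC : eigendecomposition (gradient_cov X rho f) W lam)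
    (d : measure_display) (T : measurableType d) (P : probability T R)
    (x : 'I_N -> {RV P >-> 'cV[R]_m})
    (hx : forall j, has_density rho (x j)) (hind : independent_samples x)
    (L nu eps : R)
    (hL : forall y, X y -> enorm (gradient X f y) <= L)
    (hnu : nu ^+ 2 = opnorm (gradient_fluctuation X rho f))
    (hnu0 : 0 < nu ^+ 2)
    (heps0 : 0 < eps)
    (heps : eps <= Num.min 1 ((lam n - lam n.+1) / (5 * lam 1%N))),
  let delta := Num.max (nu ^+ 2 / (lam 1%N * eps)) (L ^+ 2) in
  c * (delta / (lam 1%N * eps)) * ln (2 * m)%:R <= N%:R ->
  exists A : set T,
    [/\ measurable A,
        ((1 - m%:R `^ (- beta))%:E <= P A)%E &
        forall w, A w ->
          forall (What : 'M[R]_m) (lamhat : nat -> R),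
            eigendecomposition
              (sample_gradient_cov X f (fun j => x j w)) What lamhat ->
            dist_ran (colsub (widen_ord (ltnW hnm)) W)
                     (colsub (widen_ord (ltnW hnm)) What)
              <= 4 * lam 1%N * eps / (lam n - lam n.+1)].
Proof.
pose s := beta + 2 + (ln 2)^-1.
have ln2 : 0 < ln 2 :> R by rewrite ln_gt0// ltr1n.
have s0 : 0 < s by rewrite !addr_gt0// invr_gt0.
have e0 : 0 < expR 1 :> R := expR_gt0 1.
(* [4 * expR 1] undoes the denominator in the exponent of [covariance_concentration]; [s] is the
   constant of [failure_bound]. *)
exists (4 * expR 1 * s); first by rewrite !mulr_gt0.
move=> m n N hm hn hnm X rho f _ hrho hsep hdiff _ W lam hC d T P x hx hind
  L nu eps hL hnu hnu0 heps0 heps delta hN.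
have [_ dec _] := hC.
have gap_ge0 : 0 <= lam n - lam n.+1 by rewrite subr_ge0 dec.
have [eps1 epsgap] : eps <= 1 /\ eps <= (lam n - lam n.+1) / (5 * lam 1%N).
  by move: heps; rewrite le_min => /andP[].
(* Otherwise the upper bound on [eps] would be nonpositive, also when [lam 1] is zero, as division
   by zero yields zero. *)
have lam1 : 0 < lam 1%N.
  rewrite ltNge; apply/negP => lam0.
  have := lt_le_trans heps0 epsgap; rewrite ltNge => /negP; apply.
  by rewrite mulr_ge0_le0// invr_le0 mulr_ge0_le0.
pose eta := lam 1%N * eps; have eta0 : 0 < eta by rewrite mulr_gt0.
have gap5 : 5 * eta <= lam n - lam n.+1.
  by move: epsgap; rewrite ler_pdivlMr ?mulr_gt0// /eta; lra.
have gap0 : 0 < lam n - lam n.+1 by apply: lt_le_trans gap5; rewrite mulr_gt0.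
have delta0 : 0 < delta.
  by rewrite /delta lt_max divr_gt0.
have nu_le : opnorm (gradient_fluctuation X rho f) <= eta * delta.
  by rewrite -hnu mulrC -ler_pdivrMr// /delta le_max lexx.
have L_le : L ^+ 2 <= delta by rewrite /delta le_max lexx orbT.
have lnm : 0 < ln (2 * m)%:R :> R.
  by rewrite ln_gt0// ltr1n (leq_trans hm)// leq_pmull.
have N0 : (0 < N)%N.
  rewrite -(ltr0n R); apply: lt_le_trans hN.
  by rewrite !mulr_gt0// invr_gt0.
have [Z [mZ Z0 mgrad]] := measurable_gradient hrho hsep hdiff.
pose G := regular_gradient X Z f; pose C := gradient_cov X rho f.
have bG := bdd_meas_regular_gradient hrho mZ mgrad hL.
have bY a b : bdd_meas (fun y => (G y *m (G y)^T) a b).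
  by under eq_fun do rewrite mxE big_ord_recl big_ord0 addr0 !mxE; exact: bdd_measM.
have bD a b : bdd_meas (fun y => (G y *m (G y)^T - C) a b).
  under eq_fun do rewrite mxE; apply: bdd_measD => //; exact: bdd_meas_cst.
have EY j : ExM P (fun w => G (x j w) *m (G (x j w))^T) = C.
  apply: (ExM_off_null hrho mZ Z0 (H := fun y => G y *m (G y)^T) (hx j) bY) =>
    y XZy.
  by rewrite /grad_outer -(regular_gradientE f XZy).
have ED j : ExM P (fun w => (G (x j w) *m (G (x j w))^T - C) *m
    (G (x j w) *m (G (x j w))^T - C)) = gradient_fluctuation X rho f.
  pose H y := (G y *m (G y)^T - C) *m (G y *m (G y)^T - C).
  apply: (ExM_off_null hrho mZ Z0 (H := H) (hx j)) => [a b|y XZy].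
    exact: (closed_mulmx (@bdd_meas_cst _ _ _) (@bdd_measD _ _ _)
      (@bdd_measM _ _ _)).
  by rewrite /H /= /grad_outer -(regular_gradientE f XZy).
have [B mB [PB hB]] := covariance_concentration hind bG
  (regular_gradient_le Z hrho hL) EY ED N0 eta0 delta0 L_le nu_le.
pose A0 j := x j @^-1` (X `\` Z).
have mA0 : measurable (\bigcap_(j in [set: 'I_N]) A0 j).
  by apply: fin_bigcap_measurable => // j _;
    exact: (sample_regular hrho mZ Z0 (hx j)).1.
exists (B `&` \bigcap_(j in [set: 'I_N]) A0 j); split; first exact: measurableI.
  have A0n : P (~` \bigcap_(j in [set: 'I_N]) A0 j) = 0%E.
    (* The finite union is padded with empty sets beyond [N], to fit countable unions of negligible
       sets. *)
    pose U (i : nat) : set T := oapp (fun j => ~` A0 j) set0 (insub i).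
    have UE : ~` (\bigcap_(j in [set: 'I_N]) A0 j) = \bigcup_i U i.
      rewrite setC_bigcap; apply/seteqP; split=> w [j _ hj].
        by exists (val j) => //; rewrite /U valK.
      by move: hj; rewrite /U; case: insubP => // i _ _ hi; exists i.
    apply: measure_negligible; first exact: measurableC.
    rewrite UE; apply: negligible_bigcup => i; rewrite /U.
    case: insubP => [j _ _|_]; last exact: negligible_set0.
    have [mj Pj] := sample_regular hrho mZ Z0 (hx j).
    by exists (~` A0 j); split => //; exact: measurableC.
  have mA := measurableI _ _ mB mA0.
  rewrite -[X in P X]setCK probability_setC; last exact: measurableC.
  rewrite EFinB leeB//.
  rewrite setCI; apply: (@le_trans _ _ (P (~` B) + 0)%E).
    rewrite -A0n; apply: measureU2; exact: measurableC.
  rewrite adde0; apply: le_trans PB _; rewrite lee_fin.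
  have ked0 : 0 < 4 * expR 1 * delta by rewrite !mulr_gt0.
  apply: failure_bound => //; rewrite ler_pdivlMr// -/s.
  rewrite -ler_pdivrMr//; apply: le_trans hN; rewrite -/eta.
  by rewrite [leRHS](_ : _ = s * ln (2 * m)%:R * (4 * expR 1 * delta) / eta)//;
    ring.
move=> w [Bw Aw] What lamhat hChat.
rewrite -(mulrA 4); apply: (davis_kahan (eta := eta) hnm hn hC hChat) => //.
  exact: ltW.
rewrite /sample_gradient_cov.
rewrite (eq_bigr (fun j => G (x j w) *m (G (x j w))^T)); first exact: hB.
by move=> j _; rewrite /grad_outer -(regular_gradientE f (Aw j I)).
Qed.
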